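(* Let $c_0$ be a nonnegative integer and suppose that $\varphi(s)=c_0 s+\sum_{n=1}^\infty c_n n^{-s}$ generates a compact composition operator $C_\varphi$ on $\mathcal{H}^2$; if $c_0=0$, assume in addition that $\varphi$ is non-constant. Let $a_n(C_\varphi)$, $n\ge 1$, be its approximation numbers. (a) If $c_0=0$, then there exist $0<r<1$ and a constant $\delta>0$ such that $a_n(C_\varphi)\ge \delta r^n$ for all $n\ge 1$. (b) If $c_0=1$, then for every $\varepsilon>0$ there is a constant $\delta>0$ such that $a_n(C_\varphi)\ge \delta\, n^{-\operatorname{Re} c_1-\varepsilon}$ for all $n\ge 1$. (c) If $c_0>1$, then there exist $A>0$ and $\delta>0$ such that $a_n(C_\varphi)\ge \delta\, n^{-A}$ for all $n\ge 1$.
   Context: $\mathcal{H}^2$ is the Hilbert space of Dirichlet series $f(s)=\sum_{n\ge1} b_n n^{-s}$ with $\|f\|_{\mathcal{H}^2}^2=\sum_n |b_n|^2<\infty$; its elements are analytic in $\mathbb{C}_{1/2}$, where $\mathbb{C}_\theta=\{s\in\mathbb{C}:\operatorname{Re}s>\theta\}$. For an analytic map $\varphi:\mathbb{C}_{1/2}\to\mathbb{C}_{1/2}$, $C_\varphi f=f\circ\varphi$; $\varphi$ generates a bounded (compact) composition operator on $\mathcal{H}^2$ if $C_\varphi$ maps $\mathcal{H}^2$ into $\mathcal{H}^2$ boundedly (compactly). By the Gordon-Hedenmalm theorem, $C_\varphi$ is bounded on $\mathcal{H}^2$ if and only if $\varphi(s)=c_0s+\psi(s)$ with $c_0$ a nonnegative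 integer and $\psi(s)=\sum_{n\ge1}c_nn^{-s}$ a Dirichlet series converging uniformly in $\mathbb{C}_\varepsilon$ for every $\varepsilon>0$, such that $\psi(\mathbb{C}_0)\subset\mathbb{C}_{1/2}$ if $c_0=0$, and either $\psi\equiv0$ or $\psi(\mathbb{C}_0)\subset\mathbb{C}_0$ if $c_0\ge1$. The $n$th approximation number $a_n(T)$ of a bounded operator $T$ is the distance in operator norm from $T$ to the set of operators of rank $<n$. *)

(* Defs.v *)
From HB Require Import structures.
From mathcomp Require Import all_boot all_order all_algebra.
From mathcomp Require Import complex.
From mathcomp Require Import all_classical all_reals all_analysis.
From mathcomp Require Import ring.

Set Implicit Arguments.
Unset Strict Implicit.
Unset Printing Implicit Defensive.

Import Order.TTheory GRing.Theory Num.Theory.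
Import numFieldNormedType.Exports.

Local Open Scope classical_set_scope.
Local Open Scope ring_scope.
Local Open Scope complex_scope.

HB.instance Definition _ (R : realType) := NormedModule.copy R[i] R[i]^o.

Section Dirichlet.
Context {R : realType}.
Local Notation C := R[i].

Definition cexp (z : C) : C :=
  (expR (complex.Re z))%:C * (cos (complex.Im z) +i* sin (complex.Im z)).

(* n ^ z; only meaningful for n >= 1, as ln 0 = 0. *)
Definition npow (n : nat) (z : C) : C := cexp (z * (ln n%:R)%:C).

(* Dirichlet series start at n = 1, so the value c 0 is never used. *)
Definition dirichlet_partial (c : nat -> C) (s : C) : nat -> C :=
  fun N => \sum_(1 <= n < N) c n * npow n (- s).

Definition dirichlet (c : nat -> C) (s : C) : C := limn (dirichlet_partial c s).

Definition half_plane (theta : R) : set C := [set s | theta < complex.Re s].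

(* `|z| ^+ 2 as an element of R rather than of R[i]. *)
Definition sqmod (z : C) : R := complex.Re z ^+ 2 + complex.Im z ^+ 2.

(* [b 0 = 0] makes the coefficient sequence of a Dirichlet series unique. *)
Definition square_summable (b : nat -> C) : Prop :=
  b 0%N = 0 /\ cvgn (series (fun n => sqmod (b n))).

Definition H2_pred : {pred nat -> C} := fun b => `[< square_summable b >].

Lemma sqmod_ge0 z : 0 <= sqmod z.
Proof. by rewrite addr_ge0 ?sqr_ge0. Qed.

Lemma sqmod_eq0 z : sqmod z = 0 -> z = 0.
Proof.
case: z => x y /eqP; rewrite /sqmod paddr_eq0 ?sqr_ge0//= !sqrf_eq0.
by case/andP => /eqP -> /eqP ->.
Qed.

Lemma sqmodM z w : sqmod (z * w) = sqmod z * sqmod w.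
Proof. by case: z w => [a b] [c d]; rewrite /sqmod /=; ring. Qed.

Lemma sqmodD_le z w (t : R) : 0 < t ->
  sqmod (z + w) <= (1 + t) * sqmod z + (1 + t^-1) * sqmod w.
Proof.
move=> t0; rewrite -subr_ge0; case: z w => [a b] [c d]; rewrite /sqmod /=.
have -> : (1 + t) * (a ^+ 2 + b ^+ 2) + (1 + t^-1) * (c ^+ 2 + d ^+ 2)
    - ((a + c) ^+ 2 + (b + d) ^+ 2)
  = t * ((a - c / t) ^+ 2 + (b - d / t) ^+ 2).
  by field; rewrite gt_eqF.
by rewrite mulr_ge0 ?addr_ge0 ?sqr_ge0// ltW.
Qed.

Let cvg_seriesM (k : R) (u : R ^nat) : cvgn (series u) ->
  cvgn (series (fun n => k * u n)) /\
  limn (series (fun n => k * u n)) = k * limn (series u).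
Proof.
move=> cu; have -> : series (fun n => k * u n) = (fun n => k * series u n).
  by apply/funext => n; rewrite /series /= mulr_sumr.
suff cku : (fun n => k * series u n) @ \oo --> k * limn (series u).
  by split; [apply/cvg_ex; exists (k * limn (series u)) | exact/cvg_lim].
exact: cvgMl_tmp.
Qed.

Lemma cvg_sqmodD (b c : nat -> C) (t : R) : 0 < t ->
  cvgn (series (fun n => sqmod (b n))) -> cvgn (series (fun n => sqmod (c n))) ->
  cvgn (series (fun n => sqmod (b n + c n))) /\
  limn (series (fun n => sqmod (b n + c n))) <=
    (1 + t) * limn (series (fun n => sqmod (b n))) +
    (1 + t^-1) * limn (series (fun n => sqmod (c n))).
Proof.
move=> t0 /(cvg_seriesM (1 + t))[cb <-] /(cvg_seriesM (1 + t^-1))[cc <-].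
rewrite -lim_seriesD//; have cu := is_cvg_seriesD cb cc.
have le n : sqmod (b n + c n) <=
    (1 + t) * sqmod (b n) + (1 + t^-1) * sqmod (c n) by exact: sqmodD_le.
have cs : cvgn (series (fun n => sqmod (b n + c n))).
  apply: (series_le_cvg _ _ le cu) => n; first exact: sqmod_ge0.
  by rewrite (le_trans _ (le n)) ?sqmod_ge0.
by split => //; exact: (lim_series_le cs cu le).
Qed.

Lemma cvg_sqmodZ (a : C) (b : nat -> C) :
  cvgn (series (fun n => sqmod (b n))) ->
  cvgn (series (fun n => sqmod (a * b n))) /\
  limn (series (fun n => sqmod (a * b n))) =
    sqmod a * limn (series (fun n => sqmod (b n))).
Proof.
move=> cb; under eq_fun do rewrite sqmodM.
exact: cvg_seriesM.
Qed.

Lemma H2_submod_closed : submod_closed H2_pred.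
Proof.
split.
  apply/asboolP; split => //.
  rewrite (_ : (fun n => _) = fun=> 0 : R); last first.
    by apply/funext => n; rewrite /sqmod /= expr0n addr0.
  rewrite (_ : series _ = fun=> 0); first exact: is_cvg_cst.
  by apply/funext => n; rewrite /series /= big1.
move=> a b c /asboolP[b0 cb] /asboolP[c0 cc]; apply/asboolP; split.
  by rewrite /= [LHS](_ : _ = a * b 0%N + c 0%N)// b0 c0 mulr0 addr0.
exact: (cvg_sqmodD ltr01 (cvg_sqmodZ a cb).1 cc).1.
Qed.

HB.instance Definition _ := GRing.isSubmodClosed.Build _ _ H2_pred H2_submod_closed.

End Dirichlet.

(* The space H^2 of Dirichlet series, each being represented by its coefficient
   sequence; its values on C_{1/2}, where it converges absolutely by
   Cauchy-Schwarz, are given by [dirichlet]. *)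
Record H2 (R : realType) : Type :=
  MkH2 { coef :> nat -> R[i]; coefP : coef \in H2_pred }.

HB.instance Definition _ (R : realType) := [isSub for @coef R].
HB.instance Definition _ (R : realType) := [Choice of H2 R by <:].
HB.instance Definition _ (R : realType) := [SubChoice_isSubLmodule of H2 R by <:].

Section H2norm.
Context {R : realType}.
Implicit Types f g : H2 R.

Let N2 f : R := limn (series (fun n => sqmod (f n))).

Definition H2norm f : R := Num.sqrt (limn (series (fun n => sqmod (f n)))).

Let cvgN2 f : cvgn (series (fun n => sqmod (f n))).
Proof. by have /asboolP[] := coefP f. Qed.

Let N2_term f n : sqmod (f n) <= N2 f.
Proof.
have inc : nondecreasing_seq (series (fun n => sqmod (f n))).
  by apply: nondecreasing_series => *; exact: sqmod_ge0.
apply: le_trans (nondecreasing_cvgn_le inc (@cvgN2 f) n.+1).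
rewrite /series /= big_nat_recr//= lerDr sumr_ge0// => i _; exact: sqmod_ge0.
Qed.

Let N2_ge0 f : 0 <= N2 f.
Proof. exact: le_trans (sqmod_ge0 _) (N2_term f 0%N). Qed.

Lemma H2norm_eq0 f : H2norm f = 0 -> f = 0.
Proof.
move/eqP; rewrite sqrtr_eq0 => Nf0; apply/val_inj/funext => n /=.
by apply/sqmod_eq0/le_anti; rewrite sqmod_ge0 (le_trans (N2_term f n)).
Qed.

Lemma H2normZ (a : R[i]) f : (H2norm (a *: f))%:C = `|a| * (H2norm f)%:C.
Proof.
rewrite /H2norm (_ : (fun n => _) = fun n => sqmod (a * f n))//.
rewrite (cvg_sqmodZ a (@cvgN2 f)).2 sqrtrM ?sqmod_ge0//.
by rewrite normc_def -rmorphM.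
Qed.

Lemma H2normD f g : H2norm (f + g) <= H2norm f + H2norm g.
Proof.
have [f0|f0] := eqVneq (H2norm f) 0.
  by rewrite (H2norm_eq0 f0) add0r lerDr sqrtr_ge0.
have [g0|g0] := eqVneq (H2norm g) 0.
  by rewrite (H2norm_eq0 g0) addr0 lerDl sqrtr_ge0.
have {}f0 : 0 < H2norm f by rewrite lt_neqAle eq_sym f0 sqrtr_ge0.
have {}g0 : 0 < H2norm g by rewrite lt_neqAle eq_sym g0 sqrtr_ge0.
have := (cvg_sqmodD (divr_gt0 g0 f0) (@cvgN2 f) (@cvgN2 g)).2.
rewrite -[limn (series (fun n => sqmod (f n)))]sqr_sqrtr ?N2_ge0//.
rewrite -[limn (series (fun n => sqmod (g n)))]sqr_sqrtr ?N2_ge0//.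
rewrite -/(H2norm f) -/(H2norm g).
have -> : (1 + H2norm g / H2norm f) * H2norm f ^+ 2 +
    (1 + (H2norm g / H2norm f)^-1) * H2norm g ^+ 2 = (H2norm f + H2norm g) ^+ 2.
  by field; rewrite !gt_eqF.
move=> le; rewrite -(@ler_pXn2r _ 2) ?nnegrE ?addr_ge0 ?sqrtr_ge0//.
by rewrite sqr_sqrtr// N2_ge0.
Qed.

Lemma H2normDC f g : (H2norm (f + g))%:C <= (H2norm f)%:C + (H2norm g)%:C.
Proof. by rewrite -rmorphD lecR H2normD. Qed.

Lemma H2normC_eq0 f : (H2norm f)%:C = 0 -> f = 0.
Proof. by case=> /H2norm_eq0. Qed.

End H2norm.

HB.instance Definition _ (R : realType) :=
  Lmodule_isNormed.Build R[i] (H2 R) H2normDC H2normZ H2normC_eq0.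

Section Operators.
Context {R : realType} {V W : normedModType R[i]}.

(* The norms of V and W are real numbers seen in R[i], hence the [%:C]. *)
Definition bounded_operator (T : {linear V -> W}) : Prop :=
  exists M : R, forall x, `|T x| <= M%:C * `|x|.

Definition compact_operator (T : {linear V -> W}) : Prop :=
  bounded_operator T /\ precompact (T @` [set x | `|x| <= 1]).

Definition operator_norm (T : V -> W) : R :=
  inf [set M | 0 <= M /\ forall x, `|T x| <= M%:C * `|x|].

(* The range of T is spanned by fewer than n vectors. *)
Definition rank_lt (n : nat) (T : {linear V -> W}) : Prop :=
  exists2 m : nat, (m < n)%N &
    exists e : 'I_m -> W, forall x, exists a : 'I_m -> R[i],
      T x = \sum_i a i *: e i.

Definition approximation_number (n : nat) (T : {linear V -> W}) : R :=
  inf [set operator_norm (fun x => T x - S x) |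
        S in [set S : {linear V -> W} | bounded_operator S /\ rank_lt n S]].

End Operators.

Section CompositionOperators.
Context {R : realType}.

Definition analytic_on (D : set R[i]) (phi : R[i] -> R[i]) : Prop :=
  forall s, D s -> derivable phi s 1.

Definition analytic_self_map (phi : R[i] -> R[i]) : Prop :=
  analytic_on (half_plane 2^-1) phi /\
  forall s, half_plane 2^-1 s -> half_plane 2^-1 (phi s).

Definition is_composition_operator (phi : R[i] -> R[i])
    (T : {linear H2 R -> H2 R}) : Prop :=
  forall (f : H2 R) s, half_plane 2^-1 s ->
    dirichlet (T f) s = dirichlet f (phi s).

(* phi(s) = c0 * s + \sum_(n >= 1) c n * n ^ (- s), convergence included *)
Definition has_expansion (phi : R[i] -> R[i]) (c0 : nat) (c : nat -> R[i]) : Prop :=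
  forall s, half_plane 2^-1 s ->
    dirichlet_partial c s @ \oo --> phi s - c0%:R * s.

Definition nonconstant_on (D : set R[i]) (phi : R[i] -> R[i]) : Prop :=
  exists s t, [/\ D s, D t & phi s != phi t].

End CompositionOperators.

(* Main.v *)
Require Import Defs.
From mathcomp Require Import all_boot all_order all_algebra.
From mathcomp Require Import complex.
From mathcomp Require Import all_classical all_reals all_analysis.
From mathcomp Require Import ring lra zify.

(* A rank < n operator S kills a nonzero combination x of any n given vectors,
   so a_n(T) >= d as soon as |T x| >= d |x| on the span of n vectors.

   If c_0 >= 1, take the span of m^-s for n <= m < 2n. Since
   T (m^-s) = (m^c_0)^-s m^(-psi(s)), where the second factor is an ordinary
   Dirichlet series with constant term m^(-c_1), the coefficients of T (m^-s) are
   supported on the multiples of m^c_0. No two integers of [n, 2n) divide each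
   other, so the coefficient of T x of index m^c_0 is m^(-c_1) x_m, which gives
   a_n(T) >= min m^(-Re c_1). That m^(-psi) is an ordinary Dirichlet series is
   expressed by asymptotic expansions in powers n^-j at the integers j >= 3,
   which are stable under products and exponentials and are unique.

   If c_0 = 0, some N^(-phi) is nonconstant on a real segment, so by the
   intermediate value theorem there are n points of it whose images are
   L/n-separated; the span is that of the corresponding Lagrange interpolation
   polynomials in N^-s, whose norms grow at most geometrically. *)

Set Implicit Arguments.
Unset Strict Implicit.
Unset Printing Implicit Defensive.

Import Order.TTheory GRing.Theory Num.Theory.
Import numFieldNormedType.Exports.

Local Open Scope classical_set_scope.
Local Open Scope ring_scope.
Local Open Scope complex_scope.

(** * Lower bounds for approximation numbers *)

Section ApproximationNumbers.
Context {R : realType} {V W : normedModType R[i]}.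
Implicit Types T S : {linear V -> W}.

(** The images of the [n] vectors are combinations of [m < n] vectors; their n x m coordinate matrix
    has rank at most [m], so some nonzero row annihilates it from the left. *)
Lemma rank_lt_kernel n S (e : 'I_n -> V) : rank_lt n S ->
  exists2 a : 'I_n -> R[i], exists i, a i != 0 & S (\sum_i a i *: e i) = 0.
Proof.
move=> [m mn [w Sw]].
have /choice[b Sb] : forall i, exists b, S (e i) = \sum_j b j *: w j by [].
pose A := \matrix_(i < n, j < m) b i j.
have /eqP/rowV0Pn[u /sub_kermxP uA /rV0Pn[i ui]] : kermx A <> 0.
  move=> A0; have := mxrank_ker A; rewrite A0 mxrank0 => /esym/eqP.
  by rewrite subn_eq0 leqNgt (leq_ltn_trans (rank_leq_col A) mn).
exists (u 0); first by exists i.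
rewrite linear_sum /=; under eq_bigr do rewrite linearZ /= Sb scaler_sumr.
rewrite exchange_big big1 //= => j _; under eq_bigr do rewrite scalerA.
rewrite -scaler_suml; suff -> : \sum_i u 0 i * b i j = 0 by rewrite scale0r.
have /matrixP/(_ 0 j) := uA; rewrite !mxE => uAj; rewrite -[RHS]uAj.
by apply: eq_bigr => k _; rewrite mxE.
Qed.

(** The clause [T x != 0] excludes [x = 0], the [e i] not being assumed independent; the norm of [x]
    can then be cancelled in d |x| <= |(T - S) x| <= M |x|, where [S x = 0]. *)
Lemma approximation_number_ge n T (e : 'I_n -> V) (d : R) :
  (0 < n)%N -> bounded_operator T ->
  (forall a : 'I_n -> R[i], (exists i, a i != 0) ->
    let x := \sum_i a i *: e i in T x != 0 /\ d%:C * `|x| <= `|T x|) ->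
  d <= approximation_number n T.
Proof.
move=> n0 [MT MTP] Tlow; apply: lb_le_inf.
  (* [lb_le_inf] asks for a nonempty set: the zero operator is a competitor, of rank 0 < n. *)
  pose Z : {linear V -> W} := \0.
  exists (operator_norm (fun x => T x - Z x)); exists Z => //; split.
    by exists 0 => x; rewrite normr0 mul0r.
  exists 0%N => //; exists (fun=> 0) => x; exists (fun=> 0).
  by rewrite big_ord0.
move=> _ [S [[MS MSP] rS] <-]; apply: lb_le_inf.
  exists (`|MT| + `|MS|); split; first by rewrite addr_ge0.
  move=> x; rewrite (le_trans (ler_normB _ _))// rmorphD mulrDl lerD//.
    by rewrite (le_trans (MTP x))// ler_wpM2r// lecR ler_norm.
  by rewrite (le_trans (MSP x))// ler_wpM2r// lecR ler_norm.
move=> M [M0 MP].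
have [a a0 Sa] := rank_lt_kernel e rS.
have /= [Ta0 Ta] := Tlow a a0.
set x := \sum_i _ in Sa Ta0 Ta.
have x0 : 0 < `|x|.
  by rewrite normr_gt0; apply: contraNneq Ta0 => ->; rewrite linear0.
have := MP x; rewrite Sa subr0 => /(le_trans Ta).
by rewrite ler_pM2r// lecR.
Qed.

End ApproximationNumbers.

(** * The space H^2 and Dirichlet series *)

Section H2Elements.
Context {R : realType}.
Local Notation C := R[i].
Implicit Types f g : H2 R.

Lemma H2_normE f : `|f| = (H2norm f)%:C. Proof. by []. Qed.

Lemma sqmodE (z : C) : (sqmod z)%:C = `|z| ^+ 2.
Proof. by rewrite -add_Re2_Im2. Qed.

Lemma H2_coef_sum n (a : 'I_n -> C) (e : 'I_n -> H2 R) k :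
  (\sum_i a i *: e i) k = \sum_i a i * e i k.
Proof.
pose h (f : H2 R) := f k.
have hD : {morph h : f g / f + g >-> f + g} by [].
by rewrite -[LHS]/(h _) (big_morph h hD (erefl : h 0 = 0)).
Qed.

Lemma is_cvg_H2norm f : cvgn (series (fun n => sqmod (f n))).
Proof. by have /asboolP[] := coefP f. Qed.

Lemma sqr_H2norm f : H2norm f ^+ 2 = limn (series (fun n => sqmod (f n))).
Proof.
rewrite /H2norm sqr_sqrtr//; apply: limr_ge; first exact: is_cvg_H2norm.
by near=> n; rewrite /series /= sumr_ge0// => i _; exact: sqmod_ge0.
Unshelve. all: by end_near. Qed.

Lemma sum_sqmod_le f N : \sum_(0 <= k < N) sqmod (f k) <= H2norm f ^+ 2.
Proof.
rewrite sqr_H2norm; apply: (nondecreasing_cvgn_le _ (@is_cvg_H2norm f)).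
by apply: nondecreasing_series => *; exact: sqmod_ge0.
Qed.

Lemma H2norm_sqr_le f (B : R) :
  (forall N, \sum_(0 <= k < N) sqmod (f k) <= B) -> H2norm f ^+ 2 <= B.
Proof.
move=> fB; rewrite sqr_H2norm; apply: limr_le; first exact: is_cvg_H2norm.
by near=> n; exact: fB.
Unshelve. all: by end_near. Qed.

Lemma sum_sqmod_inj_le f n (k : 'I_n -> nat) : injective k ->
  \sum_i sqmod (f (k i)) <= H2norm f ^+ 2.
Proof.
move=> kinj; pose N := (\max_i k i).+1.
have kN i : (k i < N)%N by rewrite ltnS leq_bigmax.
apply: le_trans (sum_sqmod_le f N); rewrite big_mkord.
pose h i := Ordinal (kN i).
have hinj : injective h by move=> i j /(congr1 val)/kinj.
rewrite [leRHS](bigID [in imset h (mem predT)])/= big_imset/=; last by move=> *; exact: hinj.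
by rewrite lerDl sumr_ge0// => j _; exact: sqmod_ge0.
Qed.

(** Coefficients of m^-s. The guard sends m = 0 to the zero series, because elements of H^2 have no
    coefficient of index 0; [monomial] is thus total. *)
Definition monomial_coef (m k : nat) : C := ((0 < m)%N && (k == m))%:R.

Lemma sum_nat_eq_le (N m : nat) (x : R) : 0 <= x ->
  \sum_(0 <= k < N) (k == m)%:R * x <= x.
Proof.
move=> x0; rewrite (eq_bigr (fun k => if k == m then x else 0)); last first.
  by move=> k _; case: eqP; rewrite ?mul1r ?mul0r.
by rewrite -big_mkcond big_nat1_eq; case: ifP.
Qed.

Lemma monomial_coefP m : monomial_coef m \in H2_pred.
Proof.
apply/asboolP; split; first by rewrite /monomial_coef; case: m.
apply: nondecreasing_is_cvgn.
  by apply: nondecreasing_series => *; exact: sqmod_ge0.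
exists 1 => _ [N _ <-]; apply: le_trans (sum_nat_eq_le N m ler01).
apply: ler_sum => k _; rewrite /monomial_coef /sqmod mulr1.
by case: (0 < m)%N (k == m) => [] []/=; rewrite expr0n/= ?expr1n ?addr0.
Qed.

Definition monomial m : H2 R := MkH2 (monomial_coefP m).

Lemma monomialE m k : (0 < m)%N -> monomial m k = (k == m)%:R.
Proof. by rewrite /= /monomial_coef => ->. Qed.

(** Distinct monomials are orthonormal: each coefficient of the combination is either 0 or a single
    [a i]. *)
Lemma H2norm_sum_monomial n (a : 'I_n -> C) (m : 'I_n -> nat) :
  injective m -> (forall i, 0 < m i)%N ->
  H2norm (\sum_i a i *: monomial (m i)) ^+ 2 <= \sum_i sqmod (a i).
Proof.
move=> minj m0; apply: H2norm_sqr_le => N.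
have E k : sqmod ((\sum_i a i *: monomial (m i)) k)
    = \sum_i (k == m i)%:R * sqmod (a i).
  rewrite H2_coef_sum; under eq_bigr do rewrite monomialE//.
  have [[i ->]|nk] := pselect (exists i, k = m i).
    rewrite (bigD1 i)//= [in RHS](bigD1 i)//= eqxx mulr1 mul1r.
    rewrite !big1 ?addr0// => j ji; rewrite (inj_eq minj) eq_sym (negbTE ji).
    - by rewrite mul0r.
    - by rewrite mulr0.
  have {}nk i : k == m i = false by apply/negP => /eqP ?; apply: nk; exists i.
  rewrite !big1 => [|i _|i _]; rewrite ?nk ?mul0r ?mulr0//.
  by rewrite /sqmod expr0n/= addr0.
under eq_bigr do rewrite E; rewrite exchange_big; apply: ler_sum => i _.
by apply: sum_nat_eq_le; exact: sqmod_ge0.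
Qed.

Lemma normr_monomial_le m : `|monomial m| <= 1.
Proof.
rewrite H2_normE lecR -(@ler_pXn2r _ 2) ?nnegrE ?sqrtr_ge0// expr1n.
apply: H2norm_sqr_le => N; apply: le_trans (sum_nat_eq_le N m ler01).
apply: ler_sum => k _; rewrite /= /monomial_coef /sqmod mulr1.
by case: (0 < m)%N (k == m) => [] []/=; rewrite expr0n/= ?expr1n ?addr0.
Qed.

Lemma normr_coef_le f k : `|f k| <= `|f|.
Proof.
rewrite H2_normE normc_def lecR -(@ler_pXn2r _ 2) ?nnegrE ?sqrtr_ge0//.
rewrite sqr_sqrtr; last exact: sqmod_ge0.
apply: le_trans (sum_sqmod_le f k.+1); rewrite big_nat_recr//= lerDr sumr_ge0//.
by move=> *; exact: sqmod_ge0.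
Qed.

End H2Elements.

(** * Complex powers n^z *)

Section Npow.
Context {R : realType}.
Local Notation C := R[i].
Implicit Types z w : C.

Lemma cexpD z w : cexp (z + w) = cexp z * cexp w.
Proof.
case: z w => [a b] [c d]; apply/eqP; rewrite /cexp /= expRD sinD cosD eq_complex /=.
by apply/andP; split; apply/eqP; ring.
Qed.

Lemma cexp0 : cexp 0 = 1 :> C.
Proof. by rewrite /cexp /= expR0 cos0 sin0 mul1r. Qed.

Lemma normr_cexp z : `|cexp z| = (expR (complex.Re z))%:C.
Proof.
rewrite /cexp normrM ger0_norm ?ler0c ?expR_ge0// [X in _ * X]normc_def /=.
by rewrite cos2Dsin2 sqrtr1 mulr1.
Qed.

Lemma npowD n z w : npow n (z + w) = npow n z * npow n w.
Proof. by rewrite /npow mulrDl cexpD. Qed.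

Lemma npow0 n : npow n 0 = 1 :> C. Proof. by rewrite /npow mul0r cexp0. Qed.

Lemma npow1 z : npow 1 z = 1.
Proof. by rewrite /npow ln1 mulr0 cexp0. Qed.

Lemma npowN n z : npow n (- z) = (npow n z)^-1.
Proof.
have nn : npow n z * npow n (- z) = 1 by rewrite -npowD subrr npow0.
rewrite -[RHS]mulr1 -nn mulKf//; apply: contraTneq isT => n0.
by move: nn; rewrite n0 mul0r => /esym/eqP; rewrite oner_eq0.
Qed.

Lemma npow_natM n k z : npow n (k%:R * z) = npow n z ^+ k.
Proof.
elim: k => [|k IH]; first by rewrite mul0r npow0.
by rewrite -natr1 mulrDl mul1r npowD IH exprSr.
Qed.

Lemma npow_X n k z : (0 < n)%N -> npow (n ^ k) z = npow n z ^+ k.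
Proof.
move=> n0; rewrite -npow_natM /npow natrX lnXn ?ltr0n//.
by rewrite rmorphMn /= -mulr_natl mulrA [z * _]mulrC.
Qed.

Lemma npowN_nat n (j : nat) : (0 < n)%N -> npow n (- j%:R) = n%:R ^- j :> C.
Proof.
move=> n0; rewrite npowN -[j%:R]mulr1 npow_natM; congr (_ ^-1); congr (_ ^+ _).
rewrite /npow mul1r /cexp /= lnK ?posrE ?ltr0n// cos0 sin0 mulr1.
by rewrite rmorph_nat.
Qed.

Lemma normr_npow n z : (0 < n)%N -> `|npow n z| = (n%:R `^ complex.Re z)%:C.
Proof.
move=> n0; rewrite /npow normr_cexp /powR pnatr_eq0 gtn_eqF//.
by case: z => a b /=; rewrite mulr0 subr0.
Qed.
End Npow.

(** * Convergence and values of Dirichlet series on Re s >= 2 *)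

Section DirichletSeries.
Context {R : realType}.
Local Notation C := R[i].
Implicit Types (s : C) (f : H2 R).

Lemma normr_Re_le (z : C) : (`|complex.Re z|)%:C <= `|z|.
Proof.
rewrite normc_def lecR -(@ler_pXn2r _ 2) ?nnegrE ?sqrtr_ge0//.
by rewrite sqr_sqrtr ?sqmod_ge0// real_normK ?num_real// lerDl sqr_ge0.
Qed.

Lemma normr_Im_le (z : C) : (`|complex.Im z|)%:C <= `|z|.
Proof.
rewrite normc_def lecR -(@ler_pXn2r _ 2) ?nnegrE ?sqrtr_ge0//.
by rewrite sqr_sqrtr ?sqmod_ge0// real_normK ?num_real// lerDr sqr_ge0.
Qed.

Lemma normr_le_ReIm (z : C) :
  `|z| <= (`|complex.Re z|)%:C + (`|complex.Im z|)%:C.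
Proof.
rewrite [z in X in X <= _]complexE (le_trans (ler_normD _ _))// normrM.
rewrite !normc_def/= !expr0n/= !addr0 add0r expr1n sqrtr1 mul1r.
by rewrite !sqrtr_sqr.
Qed.

Lemma cvg_complex (u : nat -> C) (a b : R) :
  (fun n => complex.Re (u n)) @ \oo --> a ->
  (fun n => complex.Im (u n)) @ \oo --> b ->
  u @ \oo --> a +i* b.
Proof.
move=> /cvgrPdist_le ua /cvgrPdist_le ub; apply/cvgrPdist_le => e.
rewrite ltcE => /= /andP[/eqP e0 e1].
have Ee : e = (complex.Re e)%:C by case: e e0 {e1} => ? ? /= ->.
have e2 : 0 < complex.Re e / 2 by rewrite divr_gt0.
near=> n; rewrite (le_trans (normr_le_ReIm _))//.
rewrite Ee -rmorphD lecR [complex.Re e]splitr lerD//.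
  rewrite -[complex.Re _]/(complex.Re (_ - _)).
  have -> : complex.Re (a +i* b - u n) = a - complex.Re (u n) by case: (u n).
  by near: n; exact: ua.
have -> : complex.Im (a +i* b - u n) = b - complex.Im (u n) by case: (u n).
by near: n; exact: ub.
Unshelve. all: by end_near. Qed.

Lemma is_cvg_complex_series (u : nat -> C) (v : nat -> R) :
  (forall n, `|u n| <= (v n)%:C) -> cvgn (series v) ->
  cvgn (fun N => \sum_(0 <= n < N) u n).
Proof.
move=> uv cv.
have v0 n : 0 <= v n by rewrite -lecR (le_trans (normr_ge0 _) (uv n)).
(* [p] stands for the real or the imaginary part; either series converges absolutely by comparison
   with [v]. *)
have cvgp (p : C -> R) : (forall z w, p (z + w) = p z + p w) -> p 0 = 0 ->
    (forall z, `|p z|%:C <= `|z|) -> cvgn (fun N => p (\sum_(0 <= n < N) u n)).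
  move=> pD p0 pz; have -> : (fun N => p (\sum_(0 <= n < N) u n)) = series (p \o u).
    apply/funext => N; rewrite (big_morph p pD p0).
    exact: erefl.
  apply: normed_cvg; apply: (series_le_cvg _ v0 _ cv) => n /=; first exact: normr_ge0.
  by rewrite -lecR; exact: le_trans (pz _) (uv n).
have ca : cvgn (fun N => complex.Re (\sum_(0 <= n < N) u n)).
  by apply: cvgp => [[? ?] [? ?]| |]//; exact: normr_Re_le.
have cb : cvgn (fun N => complex.Im (\sum_(0 <= n < N) u n)).
  by apply: cvgp => [[? ?] [? ?]| |]//; exact: normr_Im_le.
by have := cvg_complex ca cb => /cvgP.
Qed.

Lemma sum_invsqr_le (K N : nat) : (0 < K)%N ->
  \sum_(K <= n < N) (n%:R ^- 2 : R) <= 2.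
Proof.
move=> K0; have [NK|KN] := leqP N K; first by rewrite big_geq.
(* The added term makes the induction go through: x^-2 <= 2/x - 2/(x + 1) for x >= 1. *)
suff /(_ (N - K)%N) : forall d,
    \sum_(K <= n < K + d) (n%:R ^- 2 : R) + 2 * (K + d)%:R^-1 <= 2 * K%:R^-1 :> R.
  rewrite subnKC ?(ltnW KN)// => h.
  have h1 : K%:R^-1 <= 1 :> R by rewrite invf_le1 ?ltr0n// ler1n.
  have h2 : 0 <= N%:R^-1 :> R by rewrite invr_ge0.
  lra.
elim=> [|d IH]; first by rewrite addn0 big_geq// add0r.
rewrite addnS big_nat_recr ?leq_addr//= (le_trans _ IH)//.
rewrite -addrA lerD2l -natr1; set x : R := (K + d)%:R.
have x1 : 1 <= x by rewrite ler1n addn_gt0 K0.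
rewrite -subr_ge0 (_ : _ - _ = (x - 1) / (x ^+ 2 * (x + 1))).
  by rewrite divr_ge0 ?subr_ge0// mulr_ge0 ?sqr_ge0//; lra.
by field; apply/andP; split; apply/eqP; lra.
Qed.

Lemma is_cvg_invsqr : cvgn (series (fun n => n%:R ^- 2 : R)).
Proof.
apply: nondecreasing_is_cvgn; first by apply: nondecreasing_series => *; rewrite invr_ge0 sqr_ge0.
exists 2 => _ [[|N] _ <-]; first by rewrite /series /= big_geq.
rewrite /series /= big_ltn// expr0n/= invr0 add0r; exact: sum_invsqr_le.
Qed.

Lemma invsqr_term_le f s n : 2 <= complex.Re s -> (0 < n)%N ->
  `|f n * npow n (- s)| <= `|f| * (n%:R ^- 2)%:C.
Proof.
move=> s2 n0; rewrite normrM ler_pM ?normr_coef_le// normr_npow// lecR.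
have -> : complex.Re (- s) = - complex.Re s by case: s s2.
rewrite powRN lef_pV2 ?posrE ?exprn_gt0 ?powR_gt0 ?ltr0n//.
by rewrite -powR_mulrn ?ler0n// ler_powR ?ler1n.
Qed.

(** Coefficients are bounded by the norm of [f], so on Re s >= 2 the series is dominated by that of
    n^-2. All later evaluations of series in H^2 by this bound are at integers j >= 3 or at real
    points t >= 2. *)
Lemma is_cvg_dirichlet f s : 2 <= complex.Re s -> cvgn (dirichlet_partial f s).
Proof.
move=> s2; have -> : dirichlet_partial f s =
    (fun N => \sum_(0 <= n < N) f n * npow n (- s)).
  (* The coefficient of index 0 vanishes in H^2, so the sum may start at 0 instead of 1; for N = 0
     both sums are empty. *)
  apply/funext => -[|N]; first by rewrite /dirichlet_partial !big_geq.
  rewrite /dirichlet_partial [RHS]big_ltn//.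
  by have /asboolP[-> _] := coefP f; rewrite mul0r add0r.
pose v n : R := H2norm f * n%:R ^- 2.
apply: (@is_cvg_complex_series _ v) => [[|n]|].
- have /asboolP[-> _] := coefP f.
  by rewrite mul0r normr0 ler0c /v mulr_ge0 ?sqrtr_ge0// invr_ge0 sqr_ge0.
- by rewrite (le_trans (invsqr_term_le f s2 _))// H2_normE -rmorphM.
- exact: is_cvg_seriesZ is_cvg_invsqr.
Qed.

Lemma normr_lim_le (u : nat -> C) (l : C) (b : C) :
  u @ \oo --> l -> (\forall n \near \oo, `|u n| <= b) -> `|l| <= b.
Proof.
move=> /cvgrPdist_le ul ub; apply/ler_addgt0Pl => e e0.
near \oo => n; rewrite -(subrK (u n) l) (le_trans (ler_normD _ _))// lerD//.
  by near: n; exact: ul.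
by near: n.
Unshelve. all: by end_near. Qed.

Lemma normr_dirichlet_le f s : 2 <= complex.Re s -> `|dirichlet f s| <= 2 * `|f|.
Proof.
move=> s2; have cv : dirichlet_partial f s @ \oo --> dirichlet f s := is_cvg_dirichlet s2.
apply: (normr_lim_le cv).
apply: nearW => N; rewrite (le_trans (ler_norm_sum _ _ _))//.
rewrite (@le_trans _ _ (\sum_(1 <= n < N) `|f| * (n%:R ^- 2)%:C))//.
  by apply: ler_sum_nat => n /andP[n0 _]; exact: invsqr_term_le.
rewrite -mulr_sumr mulrC ler_wpM2r// -rmorph_sum/= -(rmorph_nat (real_complex R) 2) lecR.
exact: sum_invsqr_le.
Qed.

Lemma dirichlet_partial_monomial m s N : (0 < m < N)%N ->
  dirichlet_partial (monomial m) s N = npow m (- s).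
Proof.
move=> /andP[m0 mN].
rewrite /dirichlet_partial (eq_bigr (fun k => if k == m then npow k (- s) else 0)).
  by rewrite -big_mkcond big_nat1_eq m0 mN.
by move=> k _; rewrite monomialE//; case: eqP; rewrite ?mul1r ?mul0r.
Qed.

Lemma dirichlet_monomial m s : (0 < m)%N ->
  dirichlet (monomial m) s = npow m (- s).
Proof.
move=> m0; apply/cvg_lim => //; apply: cvg_near_cst; near=> N.
rewrite dirichlet_partial_monomial// m0/=.
by near: N; exact: nbhs_infty_gt.
Unshelve. all: by end_near. Qed.

Lemma dirichlet_sum_monomial n (a : 'I_n -> C) (m : 'I_n -> nat) s :
  (forall i, 0 < m i)%N ->
  dirichlet (\sum_i a i *: monomial (m i)) s = \sum_i a i * npow (m i) (- s).
Proof.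
move=> m0; apply/cvg_lim => //; apply: cvg_near_cst; near=> N.
transitivity (\sum_i a i * dirichlet_partial (monomial (m i)) s N).
  rewrite /dirichlet_partial.
  rewrite (eq_bigr (fun k => \sum_i a i * monomial (m i) k * npow k (- s))); last first.
    by move=> k _; rewrite -mulr_suml; congr (_ * _); exact: H2_coef_sum.
  rewrite exchange_big; apply: eq_bigr => i _; rewrite mulr_sumr.
  by apply: eq_bigr => k _; rewrite mulrA.
apply: eq_bigr => i _; rewrite dirichlet_partial_monomial// m0/=.
have : (\max_i m i < N)%N by near: N; exact: nbhs_infty_gt.
by apply: leq_ltn_trans; exact: leq_bigmax.
Unshelve. all: by end_near. Qed.

End DirichletSeries.

(** * Asymptotic expansions in powers n^-j *)

Section Expansions.
Context {F : numFieldType}.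
Implicit Types (f g : nat -> F) (d : nat -> F) (K : nat).

(** The Dirichlet polynomial of the terms n < K, evaluated at s = j. The field [F] is left general
    so that the calculus serves both real and complex sequences. *)
Definition dirichlet_sum d K (j : nat) : F := \sum_(1 <= n < K) d n * n%:R ^- j.

(** f(j) = O(K^-j), over j >= 3 only: there a series with coefficients O(n) still has its tail
    dominated by the sum of n^-2. *)
Definition bigO_pow K f : Prop :=
  exists B : F, forall j, (2 < j)%N -> `|f j| <= B * K%:R ^- j.

Definition expands K f d : Prop := bigO_pow K (fun j => f j - dirichlet_sum d K j).

Definition expandable K f : Prop := exists d, expands K f d.

Lemma invX_ge0 (n j : nat) : 0 <= n%:R ^- j :> F.
Proof. by rewrite invr_ge0 exprn_ge0. Qed.
Local Hint Resolve invX_ge0 : core.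

Lemma invX_le (n K j : nat) : (0 < K <= n)%N -> n%:R ^- j <= K%:R ^- j :> F.
Proof.
move=> /andP[K0 Kn]; have n0 := leq_trans K0 Kn.
by rewrite lef_pV2 ?posrE ?exprn_gt0 ?ltr0n// lerXn2r ?nnegrE// ler_nat.
Qed.

Lemma invX_le1 (n j : nat) : (0 < n)%N -> n%:R ^- j <= 1 :> F.
Proof. by move=> n0; rewrite (le_trans (@invX_le n 1 j _))// expr1n invr1. Qed.

Lemma bigO_powP K f : bigO_pow K f ->
  exists2 B : F, 0 <= B & forall j, (2 < j)%N -> `|f j| <= B * K%:R ^- j.
Proof.
move=> [B BP]; have [K0|K0] := posnP K.
  exists 0 => // j j3; rewrite (le_trans (BP j j3))// K0 expr0n.
  by case: j j3 => // j _; rewrite invr0 mulr0 mul0r.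
exists B => //; have := le_trans (normr_ge0 (f 3%N)) (BP 3%N isT).
by rewrite pmulr_lge0// invr_gt0 exprn_gt0// ltr0n.
Qed.

Lemma bigO_powD K f g : bigO_pow K f -> bigO_pow K g ->
  bigO_pow K (fun j => f j + g j).
Proof.
move=> [A AP] [B BP]; exists (A + B) => j j3.
by rewrite (le_trans (ler_normD _ _))// mulrDl lerD ?AP ?BP.
Qed.

Lemma bigO_pow_le K f g : (forall j, (2 < j)%N -> `|f j| <= `|g j|) ->
  bigO_pow K g -> bigO_pow K f.
Proof. by move=> fg [B BP]; exists B => j j3; rewrite (le_trans (fg j j3)) ?BP. Qed.

Lemma bigO_powM K f g (A : F) : (forall j, (2 < j)%N -> `|g j| <= A) ->
  bigO_pow K f -> bigO_pow K (fun j => g j * f j).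
Proof.
move=> gA [B BP]; exists (A * B) => j j3.
by rewrite normrM -mulrA ler_pM ?gA ?BP.
Qed.

Lemma bigO_powZ K f a : bigO_pow K f -> bigO_pow K (fun j => a * f j).
Proof. exact: (@bigO_powM _ _ (fun=> a) `|a|). Qed.

Lemma bigO_pow_sub K f g h : bigO_pow K (fun j => f j - g j) ->
  bigO_pow K (fun j => g j - h j) -> bigO_pow K (fun j => f j - h j).
Proof.
move=> fg gh; apply: bigO_pow_le (bigO_powD fg gh) => j _.
by rewrite addrA subrK.
Qed.

Lemma dirichlet_sumD d e K j :
  dirichlet_sum (fun n => d n + e n) K j = dirichlet_sum d K j + dirichlet_sum e K j.
Proof. by rewrite -big_split; apply: eq_bigr => n _; rewrite mulrDl. Qed.

Lemma dirichlet_sumZ a d K j :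
  dirichlet_sum (fun n => a * d n) K j = a * dirichlet_sum d K j.
Proof. by rewrite mulr_sumr; apply: eq_bigr => n _; rewrite mulrA. Qed.

Lemma dirichlet_sum0 K j : dirichlet_sum (fun=> 0) K j = 0.
Proof. by rewrite /dirichlet_sum big1// => n _; rewrite mul0r. Qed.

Lemma normr_dirichlet_sum_le d K j : `|dirichlet_sum d K j| <= \sum_(1 <= n < K) `|d n|.
Proof.
rewrite (le_trans (ler_norm_sum _ _ _))// ler_sum_nat// => n /andP[n0 _].
by rewrite normrM [`|_ ^- _|]ger0_norm// -[leRHS]mulr1 ler_wpM2l// invX_le1.
Qed.

Lemma expandable_eq K f g : (forall j, (2 < j)%N -> f j = g j) ->
  expandable K f -> expandable K g.
Proof.
move=> fg [d fd]; exists d; apply: bigO_pow_le fd => j j3.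
by rewrite (fg j j3).
Qed.

Lemma expandable_bigO K f g : bigO_pow K (fun j => f j - g j) ->
  expandable K g -> expandable K f.
Proof. by move=> fg [d gd]; exists d; exact: bigO_pow_sub fg gd. Qed.

Lemma expandableD K f g : expandable K f -> expandable K g ->
  expandable K (fun j => f j + g j).
Proof.
move=> [d fd] [e ge]; exists (fun n => d n + e n).
apply: bigO_pow_le (bigO_powD fd ge) => j _.
by rewrite dirichlet_sumD opprD addrACA.
Qed.

Lemma expandableZ K f a : expandable K f -> expandable K (fun j => a * f j).
Proof.
move=> [d fd]; exists (fun n => a * d n).
by apply: bigO_pow_le (bigO_powZ a fd) => j _; rewrite dirichlet_sumZ -mulrBr.
Qed.

Lemma expandable0 K : expandable K (fun=> 0).
Proof.
exists (fun=> 0); exists 0 => j _.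
by rewrite dirichlet_sum0 subr0 normr0 mul0r.
Qed.

Lemma expandable_sum I (r : seq I) (P : pred I) K (f : I -> nat -> F) :
  (forall i, P i -> expandable K (f i)) ->
  expandable K (fun j => \sum_(i <- r | P i) f i j).
Proof.
move=> fP; elim: r => [|i r IH].
  by apply: expandable_eq (expandable0 K) => j _; rewrite big_nil.
case: (boolP (P i)) => Pi.
  apply: expandable_eq (expandableD (fP i Pi) IH) => j _.
  by rewrite big_cons Pi.
by apply: expandable_eq IH => j _; rewrite big_cons (negbTE Pi).
Qed.

Lemma expandable_sum_nat K a b (f : nat -> nat -> F) :
  (forall i, (a <= i)%N -> expandable K (f i)) ->
  expandable K (fun j => \sum_(a <= i < b) f i j).
Proof.
move=> fa; apply: (@expandable_eq _ (fun j => \sum_(a <= i < b | (a <= i)%N) f i j)).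
  move=> j _; rewrite [RHS]big_nat_cond [LHS]big_nat_cond.
  by apply: eq_bigl => i; case: (a <= i)%N; rewrite ?andbT.
exact: expandable_sum.
Qed.

(** For n < K this is one term of the expansion; for n >= K it belongs to the error O(K^-j). *)
Lemma expandable_invX K n : (0 < K)%N -> (0 < n)%N ->
  expandable K (fun j => n%:R ^- j).
Proof.
move=> K0 n0; have [nK|Kn] := ltnP n K.
  exists (fun k => (k == n)%:R); exists 0 => j _.
  rewrite mul0r (_ : dirichlet_sum _ _ _ = n%:R ^- j) ?subrr ?normr0//.
  rewrite /dirichlet_sum (eq_bigr (fun k => if k == n then k%:R ^- j else 0)).
    by rewrite -big_mkcond big_nat1_eq n0 nK.
  by move=> k _; case: eqP; rewrite ?mul1r ?mul0r.
exists (fun=> 0); exists 1 => j _.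
by rewrite dirichlet_sum0 subr0 mul1r ger0_norm// invX_le// K0.
Qed.

Lemma expandable_cst K a : (0 < K)%N -> expandable K (fun=> a).
Proof.
move=> K0; apply: expandable_eq (expandableZ a (@expandable_invX K 1 K0 isT)) => j _.
by rewrite expr1n invr1 mulr1.
Qed.

Lemma expandable_bounded K f : (0 < K)%N -> expandable K f ->
  exists A, forall j, (2 < j)%N -> `|f j| <= A.
Proof.
move=> K0 [d /bigO_powP[B B0 BP]]; exists (B + \sum_(1 <= n < K) `|d n|) => j j3.
rewrite -(subrK (dirichlet_sum d K j) (f j)) (le_trans (ler_normD _ _))//.
rewrite lerD ?normr_dirichlet_sum_le// (le_trans (BP j j3))//.
by rewrite -[leRHS]mulr1 ler_wpM2l// invX_le1.
Qed.

(** Replace first [g], then [f], by its truncated sum: the other factor is bounded, so the error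
    stays O(K^-j). The product of the truncated sums is a finite combination of the (n m)^-j. *)
Lemma expandableM K f g : (0 < K)%N -> expandable K f -> expandable K g ->
  expandable K (fun j => f j * g j).
Proof.
move=> K0 fK [e ge]; have [A fA] := expandable_bounded K0 fK.
have [d fd] := fK.
apply: (@expandable_bigO _ _ (fun j => dirichlet_sum d K j * dirichlet_sum e K j)).
  apply: (@bigO_pow_sub _ _ (fun j => f j * dirichlet_sum e K j)).
    by apply: bigO_pow_le (bigO_powM fA ge) => j _; rewrite -mulrBr.
  apply: bigO_pow_le (bigO_powM (fun j _ => normr_dirichlet_sum_le e K j) fd) => j _.
  by rewrite -mulrBl mulrC.
apply: (@expandable_eq _ (fun j => \sum_(1 <= n < K) \sum_(1 <= m < K)
    (d n * e m) * (n * m)%:R ^- j)) => [j _|].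
  rewrite mulr_suml; apply: eq_bigr => n _; rewrite mulr_sumr.
  by apply: eq_bigr => m _; rewrite natrM exprMn invfM mulrACA.
apply: expandable_sum_nat => n n0; apply: expandable_sum_nat => m m0.
by apply: expandableZ; apply: expandable_invX; rewrite ?muln_gt0 ?n0.
Qed.

Lemma expandableX K f k : (0 < K)%N -> expandable K f ->
  expandable K (fun j => f j ^+ k).
Proof.
move=> K0 fK; elim: k => [|k IH].
  by apply: expandable_eq (expandable_cst 1 K0).
by apply: expandable_eq (expandableM K0 fK IH) => j _; rewrite exprS.
Qed.

Lemma expandable_horner K f (p : {poly F}) : (0 < K)%N -> expandable K f ->
  expandable K (fun j => p.[f j]).
Proof.
move=> K0 fK; apply: (@expandable_eq _ (fun j => \sum_(i < size p) p`_i * f j ^+ i)).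
  by move=> j _; rewrite horner_coef.
by apply: expandable_sum => i _; apply/expandableZ/expandableX.
Qed.

(** The K-th power of O(2^-j) is O((2^K)^-j), and 2^K >= K. *)
Lemma bigO_pow_exp K f : (0 < K)%N -> bigO_pow 2 f ->
  bigO_pow K (fun j => f j ^+ K).
Proof.
move=> K0 /bigO_powP[B B0 BP]; exists (B ^+ K) => j j3.
rewrite normrX (le_trans (lerXn2r K _ _ (BP j j3))) ?nnegrE ?mulr_ge0//.
rewrite exprMn ler_wpM2l ?exprn_ge0// exprVn -exprM mulnC exprM -(natrX _ 2) invX_le//.
by rewrite K0 ltnW// ltn_expl.
Qed.

(** [p] is meant as a Taylor polynomial of [h]: p(f) is expandable by the algebra rules, and the
    remainder, of order |f|^K with f = O(2^-j), is O(K^-j). *)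
Lemma expandable_comp K (h : F -> F) f (p : {poly F}) (A M : F) :
  (0 < K)%N -> (forall j, (2 < j)%N -> `|f j| <= A) ->
  (forall x, `|x| <= A -> `|h x - p.[x]| <= M * `|x| ^+ K) ->
  bigO_pow 2 f -> expandable K f -> expandable K (fun j => h (f j)).
Proof.
move=> K0 fA hp f2 fK; apply: expandable_bigO (expandable_horner p K0 fK).
have [B B0 BP] := bigO_powP (bigO_pow_exp K0 f2); exists (`|M| * B) => j j3.
have MP := hp _ (fA j j3).
rewrite (@le_trans _ _ (`|M| * `|f j| ^+ K))//; last first.
  by rewrite -mulrA ler_wpM2l// -normrX BP.
rewrite -(ger0_norm (normr_ge0 (h (f j) - p.[f j]))).
rewrite -[`|f j| ^+ K]ger0_norm ?exprn_ge0// -normrM ger0_norm// (le_trans MP)//.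
by rewrite real_ler_norm// realE (le_trans _ MP).
Qed.

End Expansions.

#[global] Hint Resolve invX_ge0 : core.

(** * Uniqueness of expansions, and expansions of convergent Dirichlet series *)

Section Uniqueness.
Context {R : realType}.
Local Notation C := R[i].
Implicit Types (f : nat -> C) (c d e : nat -> C).

Lemma le0_geometric (x B q : R) : 0 <= q < 1 ->
  (forall j, (2 < j)%N -> x <= B * q ^+ j) -> x <= 0.
Proof.
move=> /andP[q0 q1] xq.
have cq : (fun j => B * q ^+ j) @ \oo --> (0 : R).
  rewrite -(mulr0 B); apply: cvgMl_tmp; apply: cvg_expr.
  by rewrite ger0_norm.
rewrite -(cvg_lim _ cq)//; apply: limr_ge; first by apply/cvg_ex; exists 0.
by near=> j; apply: xq; near: j; exact: nbhs_infty_gt.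
Unshelve. all: by end_near. Qed.

(** Multiplying by n^j leaves |z| <= B q^j with q = n / (n + 1) < 1; let j tend to infinity. *)
Lemma eq0_geometric (z B : C) (n : nat) : (0 < n)%N ->
  (forall j, (2 < j)%N -> `|z| * n%:R ^- j <= B * n.+1%:R ^- j) -> z = 0.
Proof.
move=> n0 zB; have n1 : 0 < n.+1%:R :> R by rewrite ltr0n.
pose q : R := n%:R / n.+1%:R.
suff : complex.Re `|z| <= 0.
  move=> z0; apply/eqP; rewrite -normr_le0.
  by rewrite -(RRe_real (normr_real z)) lecR.
apply: (@le0_geometric _ (complex.Re B) q) => [|j j3].
  by rewrite divr_ge0//= ltr_pdivrMr// mul1r ltr_nat.
have := zB j j3; rewrite -ler_pdivlMr ?invr_gt0 ?exprn_gt0 ?ltr0n// invrK.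
rewrite -mulrA -exprVn -exprMn mulrC.
have -> : n.+1%:R^-1 * n%:R = q%:C :> C.
  by rewrite /q rmorphM fmorphV !rmorph_nat mulrC.
rewrite -rmorphXn /= lecE => /andP[_].
by case: B {zB} => a b /=; rewrite mul0r subr0 mulrC.
Qed.

(** Strong induction on [n]: once the differences of smaller index vanish, the difference of index
    [n] times n^-j is O((n + 1)^-j), hence zero. *)
Lemma expands_unique K f d e : expands K f d -> expands K f e ->
  forall n, (0 < n < K)%N -> d n = e n.
Proof.
move=> fd fe; pose a n := d n - e n.
have [B B0 BP] : exists2 B : C, 0 <= B &
    forall j, (2 < j)%N -> `|dirichlet_sum a K j| <= B * K%:R ^- j.
  apply: bigO_powP; apply: bigO_pow_le (bigO_powD fe (bigO_powZ (-1) fd)) => j _.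
  rewrite mulN1r opprB addrC addrA subrK.
  rewrite -[- dirichlet_sum e K j]mulN1r -dirichlet_sumZ -dirichlet_sumD.
  rewrite le_eqVlt; apply/orP; left; apply/eqP; congr (`| _ |).
  by apply: eq_bigr => k _; rewrite /a mulN1r.
move=> n /andP[n0 nK]; apply/eqP; rewrite -subr_eq0 -/(a n); apply/eqP.
elim/ltn_ind: n n0 nK => n IH n0 nK.
apply: (@eq0_geometric _ (B + \sum_(n.+1 <= k < K) `|a k|) n n0) => j j3.
have E : a n * n%:R ^- j =
    dirichlet_sum a K j - \sum_(n.+1 <= k < K) a k * k%:R ^- j.
  apply/eqP; rewrite eq_sym subr_eq /dirichlet_sum (big_cat_nat n0 (ltnW nK))/=.
  rewrite big_nat_cond big1 ?add0r; last first.
    by move=> i /andP[/andP[i0 iN] _]; rewrite IH ?mul0r// (ltn_trans iN).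
  by rewrite big_ltn.
rewrite -[n%:R ^- j]ger0_norm// -normrM E (le_trans (ler_normB _ _))// mulrDl lerD//.
  by rewrite (le_trans (BP j j3))// ler_wpM2l// invX_le.
rewrite (le_trans (ler_norm_sum _ _ _))// mulr_suml ler_sum_nat// => k /andP[nk kK].
by rewrite normrM ler_wpM2l// ger0_norm// invX_le.
Qed.

(** Write n^-j = n^-3 n^-(j-3). One factor n is absorbed by the growth of [c], the last power is at
    most K^-(j-3), and the sum of n^-2 is at most 2; this gives the constant 2 B K^3. *)
Lemma expands_dirichlet c (B : C) (l : nat -> C) K : (0 < K)%N ->
  (forall n, (0 < n)%N -> `|c n| <= B * n%:R) ->
  (forall j, (2 < j)%N -> dirichlet_partial c j%:R @ \oo --> l j) ->
  expands K l c.
Proof.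
move=> K0 cB cl; exists (B * K%:R ^+ 3 * 2) => j j3.
have B0 : 0 <= B by have := le_trans (normr_ge0 _) (cB 1%N isT); rewrite mulr1.
apply: (@normr_lim_le _ (fun N => dirichlet_partial c j%:R N - dirichlet_sum c K j)).
  by apply: cvgB; [exact: cl | exact: cvg_cst].
near=> N.
have KN : (K <= N)%N by near: N; exact: nbhs_infty_ge.
have -> : dirichlet_partial c j%:R N - dirichlet_sum c K j =
    \sum_(K <= n < N) c n * n%:R ^- j.
  apply/eqP; rewrite subr_eq addrC; apply/eqP.
  rewrite -big_cat_nat//=; apply: eq_big_nat => n /andP[n0 _].
  by rewrite npowN_nat.
rewrite (le_trans (ler_norm_sum _ _ _))//.
rewrite (@le_trans _ _ (\sum_(K <= n < N) B * K%:R ^+ 3 * K%:R ^- j * (n%:R ^- 2)%:C))//.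
  apply: ler_sum_nat => n /andP[Kn nN]; have n0 := leq_trans K0 Kn.
  rewrite normrM [`|_ ^- _|]ger0_norm//.
  rewrite (le_trans (ler_wpM2r (invX_ge0 _ _) (cB n n0)))//.
  have nK m : (0 < m)%N -> m%:R ^- j = m%:R ^- 3 * m%:R ^- (j - 3) :> C.
    move=> m0; rewrite -invfM -exprD addnC subnK//.
  have nz m : (0 < m)%N -> m%:R != 0 :> C by move=> ?; rewrite pnatr_eq0 -lt0n.
  have -> : B * n%:R * n%:R ^- j = B * (n%:R ^- 2 * n%:R ^- (j - 3)).
    by rewrite (nK n n0); move: (_ ^- (j - 3)) => y; field; rewrite nz.
  have -> : B * K%:R ^+ 3 * K%:R ^- j * (n%:R ^- 2)%:C =
      B * (n%:R ^- 2 * K%:R ^- (j - 3)).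
    rewrite (nK K K0) fmorphV rmorphXn /= rmorph_nat.
    by move: (_ ^- (j - 3)) => y; field; rewrite !nz.
  by rewrite !ler_wpM2l// invX_le// K0.
rewrite -mulr_sumr [leRHS]mulrAC ler_wpM2l ?mulr_ge0 ?exprn_ge0//.
by rewrite -rmorph_sum/= -(rmorph_nat (real_complex R) 2) lecR sum_invsqr_le.
Unshelve. all: by end_near. Qed.

(** Multiplication by M^-j moves the coefficient of index n to index M n and turns the error O(K^-j)
    into O((M K)^-j). *)
Lemma expands_dilate K M f d : (0 < K)%N -> (0 < M)%N -> expands K f d ->
  expands (M * K) (fun j => M%:R ^- j * f j)
    (fun k => if (M %| k)%N then d (k %/ M)%N else 0).
Proof.
move=> K0 M0 [B BP]; exists B => j j3.
have -> : dirichlet_sum (fun k => if (M %| k)%N then d (k %/ M)%N else 0) (M * K) j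
    = M%:R ^- j * dirichlet_sum d K j.
  elim: K K0 {BP} => // -[_ _|K IH _].
    rewrite muln1 /dirichlet_sum [in RHS]big_geq// mulr0 big_nat_cond big1//.
    move=> i /andP[/andP[i0 iM] _]; rewrite (negbTE (_ : ~~ (M %| i)%N)) ?mul0r//.
    by apply/negP => /(dvdn_leq i0); rewrite leqNgt iM.
  (* In the last block of length [M], only the first index is a multiple of [M]. *)
  rewrite /dirichlet_sum (big_cat_nat (n := M * K.+1)) ?muln_gt0 ?M0 ?leq_mul//=.
  rewrite -/(dirichlet_sum _ _ _) IH// big_nat_recr//= mulrDr; congr (_ + _).
  rewrite big_ltn ?ltn_pmul2l// dvdn_mulr// mulKn// big_nat_cond big1 ?addr0.
    by rewrite natrM exprMn invfM mulrCA.
  move=> i /andP[/andP[i0 iM] _]; rewrite (negbTE (_ : ~~ (M %| i)%N)) ?mul0r//.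
  apply/negP => /dvdnP[q iq]; move: i0 iM; rewrite iq [(q * M)%N]mulnC !ltn_pmul2l//.
  by rewrite ltnS => /leq_trans h /h; rewrite ltnn.
rewrite -mulrBr normrM ger0_norm// natrM exprMn invfM mulrCA.
by rewrite ler_wpM2l// BP.
Qed.

End Uniqueness.

(** * Exponentials of expansions *)

Section Taylor.
Context {R : realType}.

(** Serves as the induction step of [taylor], and with J = 0 as a Lipschitz bound at 0. *)
Lemma mean_value_pow (g dg : R -> R) (A M : R) (J : nat) : 0 <= M ->
  (forall x : R, is_derive x (1 : R) g (dg x)) ->
  (forall x, `|x| <= A -> `|dg x| <= M * `|x| ^+ J) ->
  forall x, `|x| <= A -> `|g x - g 0| <= M * `|x| ^+ J.+1.
Proof.
move=> M0 gdg dgM x xA.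
have gc : continuous g.
  move=> y; apply/differentiable_continuous/derivable1_diffP.
  exact: (@ex_derive _ _ _ _ _ _ _ (gdg y)).
have [c cx E] : exists2 c, `|c| <= `|x| & `|g x - g 0| = `|dg c| * `|x|.
  have [x0|x0] := leP 0 x.
    have [c /itvP cx E] := MVT_segment x0 (fun y _ => gdg y) (continuous_subspaceT gc).
    exists c; first by rewrite !ger0_norm ?cx.
    by rewrite E normrM subr0.
  have [c /itvP cx E] := MVT_segment (ltW x0) (fun y _ => gdg y) (continuous_subspaceT gc).
  exists c; first by rewrite !ler0_norm ?cx ?(ltW x0)// lerN2 cx.
  by rewrite distrC E normrM sub0r normrN.
rewrite E exprSr mulrA ler_wpM2r// (le_trans (dgM _ (le_trans cx xA)))//.
by rewrite ler_wpM2l ?lerXn2r ?nnegrE.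
Qed.

(** [f i] is the i-th derivative of [f 0]. By induction, approximate the derivative [f 1] and
    integrate the polynomial obtained. *)
Lemma taylor (f : nat -> R -> R) (A M : R) (J : nat) : 0 <= M ->
  (forall i (x : R), is_derive x (1 : R) (f i) (f i.+1 x)) ->
  (forall i x, `|x| <= A -> `|f i x| <= M) ->
  exists p : {poly R}, forall x, `|x| <= A -> `|f 0%N x - p.[x]| <= M * `|x| ^+ J.
Proof.
move=> M0 df fM; elim: J f df fM => [|J IH] f df fM.
  by exists 0 => x xA; rewrite horner0 subr0 mulr1 fM.
have [p pP] := IH (fun i => f i.+1) (fun i => df i.+1) (fun i => fM i.+1).
(* The antiderivative of [p] with value [f 0 0] at 0. The term i = 0 of the first summand is a
   division by 0, equal to 0, so the constant term is [f 0 0] alone. *)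
pose q : {poly R} := (\poly_(i < (size p).+1) (p`_i.-1 / i%:R)) + (f 0%N 0)%:P.
have q0 : q.[0] = f 0%N 0.
  by rewrite hornerD hornerC horner_coef0 coef_poly invr0 mulr0 add0r.
have dq : q^`() = p.
  apply/polyP => i; rewrite derivD derivC addr0 coef_deriv coef_poly /= ltnS.
  case: ltnP => [_|/(nth_default 0) ->]; last by rewrite mul0rn.
  by rewrite -[LHS]mulr_natr divfK// pnatr_eq0.
exists q => x xA.
have := @mean_value_pow (fun y => f 0%N y - q.[y]) (fun y => f 1%N y - p.[y]) A M J M0 _ pP x xA.
rewrite q0 subrr subr0; apply => y.
have := is_deriveB (df 0%N y) (is_derive_poly q y).
by rewrite dq.
Qed.

End Taylor.

(** * Stability of expansions under the real exponential, cosine and complex exponential *)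

Section ExpandableExponential.
Context {R : realType}.
Local Notation C := R[i].
Implicit Types (u v : nat -> R).

Lemma expandable_family (f : nat -> R -> R) (M : R -> R) u K : (0 < K)%N ->
  (forall A, 0 <= M A) ->
  (forall i (x : R), is_derive x (1 : R) (f i) (f i.+1 x)) ->
  (forall A i x, `|x| <= A -> `|f i x| <= M A) ->
  bigO_pow 2 u -> expandable K u ->
  expandable K (fun j => f 0%N (u j)) /\
  bigO_pow 2 (fun j => f 0%N (u j) - f 0%N 0).
Proof.
move=> K0 M0 df fM u2 uK; have [A uA] := expandable_bounded K0 uK.
have [p pP] := taylor K (M0 A) df (fM A).
split; first exact: expandable_comp pP u2 uK.
apply: bigO_pow_le (bigO_powZ (M A) u2) => j j3.
rewrite normrM ger0_norm// -[X in _ <= _ * X]expr1.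
apply: (@mean_value_pow R (f 0%N) (f 1%N) A (M A) 0 (M0 A) (df 0%N)); rewrite ?uA// => x xA.
by rewrite mulr1 fM.
Qed.

Lemma expandable_expR u K : (0 < K)%N -> bigO_pow 2 u -> expandable K u ->
  expandable K (fun j => expR (u j)) /\ bigO_pow 2 (fun j => expR (u j) - 1).
Proof.
move=> K0 u2 uK; rewrite -(@expR0 R).
apply: (@expandable_family (fun=> expR) expR) => // A _ x xA.
by rewrite ger0_norm ?expR_ge0// ler_expR (le_trans _ xA)// ler_norm.
Qed.

(** The derivatives of cosine are its translates by multiples of pi / 2, all bounded by 1. The shift
    a = - pi / 2 covers the sine. *)
Lemma expandable_cos (a : R) u K : (0 < K)%N -> bigO_pow 2 u -> expandable K u ->
  expandable K (fun j => cos (u j + a)) /\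
  bigO_pow 2 (fun j => cos (u j + a) - cos a).
Proof.
move=> K0 u2 uK.
pose f i x := cos (x + (a + (pi / 2) *+ i)) : R.
have [] := @expandable_family f (fun=> 1) u K K0 (fun=> ler01) _ _ u2 uK.
- move=> i x; rewrite /f.
  rewrite [in cos (x + _)]mulrSr [a + (_ + _)]addrA [x + (_ + pi / 2)]addrA.
  rewrite cosDpihalf -[- _]mulr1.
  apply: (@is_derive1_comp _ cos (fun x : R => x + (a + pi / 2 *+ i))).
  have := is_deriveD (is_derive_id x 1) (is_derive_cst (a + pi / 2 *+ i) x 1).
  by rewrite addr0.
- by move=> _ i x _; rewrite ler_norml cos_geN1 cos_le1.
by rewrite /f /= mulr0n addr0 add0r.
Qed.

Lemma bigO_pow_complex u K : bigO_pow K u -> bigO_pow K (fun j => (u j)%:C).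
Proof.
move=> [B BP]; exists B%:C => j j3; rewrite normc_def/= expr0n addr0 sqrtr_sqr.
by rewrite -(rmorph_nat (real_complex R)) -rmorphXn -fmorphV -rmorphM lecR BP.
Qed.

Lemma dirichlet_sum_complex (d : nat -> R) K j :
  dirichlet_sum (fun n => (d n)%:C) K j = (dirichlet_sum d K j)%:C.
Proof.
rewrite rmorph_sum/=; apply: eq_bigr => n _.
by rewrite rmorphM/= fmorphV/= rmorphXn/= rmorph_nat.
Qed.

Lemma expandable_complex u K : expandable K u -> expandable K (fun j => (u j)%:C).
Proof.
move=> [d ud]; exists (fun n => (d n)%:C).
apply: bigO_pow_le (bigO_pow_complex ud) => j _.
by rewrite dirichlet_sum_complex -rmorphB.
Qed.

Lemma bigO_pow_part (p : C -> R) (f : nat -> C) K :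
  (forall z, (`|p z|)%:C <= `|z|) -> bigO_pow K f -> bigO_pow K (fun j => p (f j)).
Proof.
move=> pz /bigO_powP[B B0 BP]; exists (complex.Re B) => j j3.
rewrite -lecR (le_trans (pz _))// (le_trans (BP j j3))//.
rewrite rmorphM/= fmorphV/= rmorphXn/= rmorph_nat.
by rewrite RRe_real// ger0_real.
Qed.

(** For [p] the real or imaginary part: [p] is real-linear, and the n^-j are real, so it acts on the
    coefficients. *)
Lemma expandable_part (p : C -> R) (f : nat -> C) K :
  (forall z, (`|p z|)%:C <= `|z|) -> (forall z w, p (z + w) = p z + p w) ->
  (forall z (x : R), p (z * x%:C) = p z * x) ->
  expandable K f -> expandable K (fun j => p (f j)).
Proof.
move=> pz pD pM [d fd]; exists (fun n => p (d n)).
have p0 : p 0 = 0 by rewrite -(mulr0 0) -[0 in X in _ * X]/(0%:C) pM mulr0.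
apply: bigO_pow_le (bigO_pow_part pz fd) => j _.
have -> : dirichlet_sum (fun n => p (d n)) K j = p (dirichlet_sum d K j).
  rewrite /dirichlet_sum (big_morph p pD p0); apply: eq_bigr => n _.
  by rewrite -pM fmorphV/= rmorphXn/= rmorph_nat.
have -> : p (f j - dirichlet_sum d K j) = p (f j) + p (dirichlet_sum d K j * (-1)%:C).
  by rewrite -pD rmorphN1 mulrN1.
by rewrite pM mulrN1.
Qed.

Lemma expandable_cexp (w : nat -> C) K : (0 < K)%N -> bigO_pow 2 w ->
  expandable K w ->
  expandable K (fun j => cexp (w j)) /\ bigO_pow 2 (fun j => cexp (w j) - 1).
Proof.
move=> K0 w2 wK.
have u2 := bigO_pow_part (@normr_Re_le R) w2.
have v2 := bigO_pow_part (@normr_Im_le R) w2.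
have uK : expandable K (fun j => complex.Re (w j)).
  apply: expandable_part wK => [|[? ?] [? ?]|[? ?] x]//=; first exact: normr_Re_le.
  by rewrite mulr0 subr0.
have vK : expandable K (fun j => complex.Im (w j)).
  apply: expandable_part wK => [|[? ?] [? ?]|[? ?] x]//=; first exact: normr_Im_le.
  by rewrite mulr0 add0r.
have [eK e2] := expandable_expR K0 u2 uK.
have [cK c2] := expandable_cos 0 K0 v2 vK.
have [sK s2] := expandable_cos (- (pi / 2)) K0 v2 vK.
have E (x : R) : cos x +i* sin x = (cos (x + 0))%:C + 'i * (cos (x - pi / 2))%:C.
  by rewrite addr0 cosBpihalf [LHS]complexE.
have csK : expandable K (fun j => cos (complex.Im (w j)) +i* sin (complex.Im (w j))).
  apply: expandable_eq (expandableD (expandable_complex cK)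
    (expandableZ 'i (expandable_complex sK))) => j _.
  by rewrite [RHS]E.
split.
  apply: expandable_eq (expandableM K0 (expandable_complex eK) csK) => j _.
  by [].
pose cs j := cos (complex.Im (w j)) +i* sin (complex.Im (w j)).
have cs1 j : (2 < j)%N -> `|cs j| <= 1.
  by move=> _; rewrite normc_def/= cos2Dsin2 sqrtr1.
(* With w = u + i v and cs = cos v + i sin v, split exp w - 1 as cs (exp u - 1) + (cs - 1). *)
apply: bigO_pow_le (bigO_powD (bigO_powM cs1 (bigO_pow_complex e2))
  (bigO_powD (bigO_pow_complex c2) (bigO_powZ 'i (bigO_pow_complex s2)))) => j _.
rewrite cos0 cosN cos_pihalf subr0 2!rmorphB/= mulrBr mulr1.
rewrite [X in _ <= `|_ + X|]addrAC -E -/(cs j) addrA subrK.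
by rewrite /cexp -/(cs j) mulrC.
Qed.

End ExpandableExponential.

(** * Composition operators with c_0 >= 1 *)

Section CompositionCoefficients.
Context {R : realType}.
Local Notation C := R[i].

(** Taking the constant term out of psi leaves a sequence O(2^-j), as the exponential requires; the
    factor exp(-c_1 L) is put back afterwards. For K = 2 the expansion consists of the constant term
    alone. *)
Lemma expands_cexp (psi c : nat -> C) (L : R) :
  (forall K, (0 < K)%N -> expands K psi c) ->
  (forall K, (0 < K)%N -> expandable K (fun j => cexp (- psi j * L%:C))) /\
  expands 2 (fun j => cexp (- psi j * L%:C)) (fun=> cexp (- c 1%N * L%:C)).
Proof.
move=> psic; pose w j := - (psi j - c 1%N) * L%:C.
have one (d : nat -> C) j : dirichlet_sum d 2 j = d 1%N.
  by rewrite /dirichlet_sum big_nat1 expr1n invr1 mulr1.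
have w2 : bigO_pow 2 w.
  apply: bigO_pow_le (bigO_powZ (- L%:C) (psic 2%N isT)) => j _.
  by rewrite one /w mulNr mulNr mulrC.
have wK K : (0 < K)%N -> expandable K w.
  move=> K0; have psiK : expandable K psi by exists c; exact: psic.
  apply: expandable_eq (expandableZ (- L%:C)
    (expandableD psiK (expandable_cst (- c 1%N) K0))) => j _.
  by rewrite /w mulNr mulNr mulrC.
have E j : cexp (- psi j * L%:C) = cexp (- c 1%N * L%:C) * cexp (w j).
  by rewrite -cexpD /w -mulrDl opprB addrA addNr add0r.
split=> [K K0|].
  apply: expandable_eq (expandableZ (cexp (- c 1%N * L%:C))
    (expandable_cexp K0 w2 (wK K K0)).1).
  by move=> j _; rewrite E.
apply: bigO_pow_le (bigO_powZ (cexp (- c 1%N * L%:C))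
  (@expandable_cexp _ w 2 isT w2 (wK 2%N isT)).2).
by move=> j _; rewrite one E mulrBr mulr1.
Qed.

Variables (phi : C -> C) (c0 : nat) (c : nat -> C) (T : {linear H2 R -> H2 R}).
Hypotheses (phiE : has_expansion phi c0 c) (TE : is_composition_operator phi T).

Lemma Re_natC (j : nat) : complex.Re (j%:R : C) = j%:R.
Proof. by rewrite -(rmorph_nat (real_complex R)). Qed.

Lemma half_plane_nat (j : nat) : (0 < j)%N -> half_plane (2^-1 : R) j%:R.
Proof.
move=> j0; rewrite /half_plane/= Re_natC.
by rewrite (@lt_le_trans _ _ 1) ?ler1n// invf_lt1// ltr1n.
Qed.

(** The series converges at s = 1, so its terms c_n / n are bounded. *)
Lemma normr_coef_expansion : exists B : C, forall n, (0 < n)%N -> `|c n| <= B * n%:R.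
Proof.
have /cvgrPdist_le/(_ 1 ltr01)[N _ NP] := phiE (@half_plane_nat 1 isT).
(* From [N] on, two consecutive partial sums lie within 1 of the limit, whence the 2; the sum takes
   care of the indices below [N]. *)
exists (2 + \sum_(i < N) `|c i|) => n n0; have [nN|Nn] := ltnP n N.
  rewrite (@le_trans _ _ (2 + \sum_(i < N) `|c i|))//.
    rewrite (bigD1 (Ordinal nN))//= addrCA lerDl addr_ge0//.
    by rewrite sumr_ge0.
  by rewrite ler_peMr ?ler1n// addr_ge0// sumr_ge0.
have E : c n * n%:R ^- 1 = dirichlet_partial c 1%:R n.+1 - dirichlet_partial c 1%:R n.
  by rewrite /dirichlet_partial big_nat_recr//= addrAC subrr add0r npowN_nat.
have : `|c n * n%:R ^- 1| <= 2.
  rewrite E (le_trans (ler_distD (phi 1%:R - c0%:R * 1%:R) _ _))//.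
  rewrite -[2]/(1 + 1) lerD//; last exact: NP.
  by rewrite distrC; apply: NP; exact: leqW.
rewrite normrM normfV [`|n%:R ^+ 1|]ger0_norm ?exprn_ge0// ler_pdivrMr ?exprn_gt0 ?ltr0n// expr1.
by move=> /le_trans; apply; rewrite ler_wpM2r// lerDl sumr_ge0.
Qed.

Lemma expands_expansion K : (0 < K)%N ->
  expands K (fun j => phi j%:R - c0%:R * j%:R) c.
Proof.
move=> K0; have [B BP] := normr_coef_expansion.
apply: expands_dirichlet BP _ => // j j3.
by apply/phiE/half_plane_nat; exact: ltn_trans j3.
Qed.

Lemma expands_H2 (f : H2 R) K : (0 < K)%N ->
  expands K (fun j => dirichlet f j%:R) f.
Proof.
move=> K0; apply: (@expands_dirichlet _ _ `|f|) => // [n n0|j j3].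
  by rewrite (le_trans (normr_coef_le f n))// ler_peMr ?ler1n.
by apply: is_cvg_dirichlet; rewrite Re_natC ler_nat ltnW.
Qed.

Lemma coef_image_monomial m : (0 < m)%N ->
  (forall k, (0 < k)%N -> ~~ (m ^ c0 %| k)%N -> T (monomial m) k = 0) /\
  T (monomial m) (m ^ c0)%N = npow m (- c 1%N).
Proof.
move=> m0; set M := (m ^ c0)%N; set g := T (monomial m).
have M0 : (0 < M)%N by rewrite expn_gt0 m0.
pose L : R := ln m%:R.
have [h_expandable h_expands2] := expands_cexp L expands_expansion.
set h := fun j => cexp _ in h_expands2 h_expandable.
have gE j : (2 < j)%N -> dirichlet g j%:R = M%:R ^- j * h j.
  move=> j3; rewrite TE; last by apply: half_plane_nat; exact: ltn_trans j3.
  rewrite dirichlet_monomial//.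
  have -> : - phi j%:R = c0%:R * - j%:R + - (phi j%:R - c0%:R * j%:R) by ring.
  rewrite npowD npow_natM npowN_nat// /M natrX; congr (_ * _).
  by rewrite exprVn -!exprM mulnC.
(* Both the coefficients of [g] and the dilated coefficients [d] expand M^-j h(j), where h(j) =
   m^(-psi(j)); by uniqueness they agree. *)
have g_expands K d : (0 < K)%N -> expands K h d ->
    forall k, (0 < k < M * K)%N -> g k = if (M %| k)%N then d (k %/ M)%N else 0.
  move=> K0 hd; apply: (@expands_unique _ (M * K) (fun j => M%:R ^- j * h j)).
    apply: bigO_pow_le (@expands_H2 g (M * K) _); last by rewrite muln_gt0 M0.
    by move=> j j3; rewrite gE.
  exact: expands_dilate.
split=> [k k0 Mk|].
  have [d hd] := h_expandable k.+1 isT.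
  rewrite (g_expands _ _ _ hd)// ?(negbTE Mk)// k0/=.
  by rewrite (leq_trans (ltnSn k))// leq_pmull.
(* K = 2 suffices to reach the index M < 2 M, which corresponds to the constant term of [h]. *)
rewrite (g_expands _ _ _ h_expands2)// ?dvdnn ?divnn ?M0 ?muln2 -?addnn//.
by rewrite -[ltnLHS]addn0 ltn_add2l.
Qed.

End CompositionCoefficients.

(** * The polynomial lower bound for c_0 >= 1 *)

Section PolynomialDecay.
Context {R : realType}.
Local Notation C := R[i].
Variables (phi : C -> C) (c0 : nat) (c : nat -> C) (T : {linear H2 R -> H2 R}).
Hypotheses (phiE : has_expansion phi c0 c) (TE : is_composition_operator phi T).
Hypothesis (Tb : bounded_operator T).

(** For rho >= 0 the power increases with its base; for rho < 0 it is smallest at 2 n, where the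
    factor 2^rho appears. The absolute value treats both signs at once. *)
Lemma powR_double_ge (rho : R) (n m : nat) : (0 < n)%N -> (n <= m <= n + n)%N ->
  2 `^ (- `|rho|) * n%:R `^ rho <= m%:R `^ rho.
Proof.
move=> n0 /andP[nm m2n]; have m0 := leq_trans n0 nm.
have [r0|r0] := leP 0 rho.
  rewrite (@le_trans _ _ (n%:R `^ rho))//.
    by rewrite ger_pMl ?powR_gt0 ?ltr0n// -[leRHS](powRr0 2) ler_powR ?ler1n// oppr_le0.
  by rewrite ge0_ler_powR ?nnegrE// ler_nat.
rewrite ltr0_norm// opprK -powRM// -natrM mul2n -addnn.
rewrite -[rho]opprK powRN [leRHS]powRN lef_pV2 ?posrE ?powR_gt0 ?ltr0n ?addn_gt0 ?n0//.
by rewrite ge0_ler_powR ?nnegrE ?oppr_ge0 ?(ltW r0)// ler_nat.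
Qed.

Lemma approximation_number_ge_powR n : (0 < c0)%N -> (0 < n)%N ->
  2 `^ (- `|complex.Re (c 1%N)|) * n%:R `^ (- complex.Re (c 1%N))
    <= approximation_number n T.
Proof.
move=> c00 n0; set rho := complex.Re (c 1%N); set d := (X in X <= _).
have d0 : 0 < d by rewrite mulr_gt0 ?powR_gt0 ?ltr0n.
pose m (i : 'I_n) := (n + i)%N.
have m0 i : (0 < m i)%N by rewrite addn_gt0 n0.
have minj : injective m by move=> i j /addnI/val_inj.
apply: (approximation_number_ge (e := fun i => monomial (m i))) => // a [i0 ai0] x.
have Tx i : T x (m i ^ c0)%N = a i * npow (m i) (- c 1%N).
  rewrite /x linear_sum /=.
  rewrite (eq_bigr (fun k => a k *: T (monomial (m k)))); last first.
    by move=> k _; rewrite linearZ.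
  rewrite H2_coef_sum (bigD1 i)//= (coef_image_monomial phiE TE (m0 i)).2.
  rewrite big1 ?addr0// => k ki.
  rewrite (coef_image_monomial phiE TE (m0 k)).1 ?mulr0 ?expn_gt0 ?m0//.
  (* If m_k divides m_i, the quotient cannot be 0 as m_i > 0, nor 1 as k and i differ; a quotient of
     at least 2 would give m_i >= 2 n. *)
  rewrite dvdn_pexp2r//; apply/negP => /dvdnP[[|[|q]]] mq.
  - by move: (m0 i); rewrite mq.
  - by move: ki; rewrite -(inj_eq minj) mq mul1n eqxx.
  have : (m i < n + n)%N by rewrite ltn_add2l.
  rewrite mq ltnNge => /negP; apply.
  by rewrite (@leq_trans (2 * m k))// ?leq_mul2r ?orbT// mul2n -addnn leq_add// leq_addr.
(* Bound the norm of [T x] from below by its coefficients at the [n] distinct indices m_i^c_0. *)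
have low : d ^+ 2 * \sum_i sqmod (a i) <= H2norm (T x) ^+ 2.
  pose k (i : 'I_n) := (m i ^ c0)%N.
  have kinj : injective k by move=> i j /eqP; rewrite eqn_exp2r// => /eqP/minj.
  apply: le_trans (sum_sqmod_inj_le (T x) kinj); rewrite mulr_sumr ler_sum// => i _.
  rewrite Tx sqmodM mulrC ler_wpM2l ?sqmod_ge0//.
  rewrite -lecR sqmodE normr_npow// rmorphXn lerXn2r ?nnegrE ?ler0c ?powR_ge0 ?(ltW d0)//.
  rewrite lecR; have -> : complex.Re (- c 1%N) = - rho by rewrite /rho; case: (c 1%N).
  by rewrite /d -(normrN rho) powR_double_ge// leq_addr leq_add2l ltnW//=.
have x_le := H2norm_sum_monomial a minj m0.
have H0 (y : H2 R) : 0 <= H2norm y by exact: sqrtr_ge0.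
have Tx_le : d * H2norm x <= H2norm (T x).
  rewrite -(@ler_pXn2r _ 2) ?nnegrE ?H0 ?mulr_ge0 ?H0 ?(ltW d0)// exprMn (le_trans _ low)//.
  by rewrite ler_wpM2l// sqr_ge0.
split; last by rewrite !H2_normE -rmorphM lecR.
rewrite -normr_eq0 H2_normE; apply/eqP => -[Tx0].
move: low; rewrite Tx0 expr0n/= pmulr_rle0 ?exprn_gt0//.
rewrite leNgt => /negP; apply; rewrite (bigD1 i0)//=.
rewrite ltr_wpDr ?sumr_ge0// => [i _|]; first exact: sqmod_ge0.
rewrite lt_neqAle sqmod_ge0 andbT eq_sym; apply: contra ai0 => /eqP/sqmod_eq0 ->.
by [].
Qed.

End PolynomialDecay.

(** * Composition operators with c_0 = 0 *)

Section ProductOfDistances.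
Local Open Scope nat_scope.

(** n^n is at most (n + 1) ... (2 n), which equals n! times a central binomial coefficient, itself
    at most 4^n. *)
Lemma expn_le_fact n : n ^ n <= 4 ^ n * n`!.
Proof.
apply: (@leq_trans ('C(n + n, n) * n`!)).
  rewrite bin_ffact ffact_prod -[X in _ ^ X]card_ord -prod_nat_const.
  by apply: leq_prod => i _; rewrite -addnBA ?leq_addr// ltnW.
rewrite leq_mul2r -[4]/(2 ^ 2) -expnM mul2n -addnn.
have -> : 2 ^ (n + n) = \sum_(i < (n + n).+1) 'C(n + n, i).
  rewrite -[2]/(1 + 1) expnDn; apply: eq_bigr => i _.
  by rewrite !exp1n !muln1.
have nn : n < (n + n).+1 by rewrite ltnS leq_addr.
by rewrite (bigD1 (Ordinal nn))//= leq_addr orbT.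
Qed.

(** With truncated subtraction the factor is |k - i|; indices below [i] contribute i!, those above
    (n - 1 - i)!. *)
Lemma prod_dist_fact n i : i < n ->
  \prod_(0 <= k < n | k != i) ((k - i) + (i - k)) = i`! * (n.-1 - i)`!.
Proof.
move=> iN; rewrite (big_cat_nat (n := i)) ?(ltnW iN)//= [X in _ * X]big_ltn_cond// eqxx /=.
congr (_ * _).
  rewrite big_nat_cond (eq_bigl (fun k => 0 <= k < i)); last first.
    by move=> k; case: ltngtP; rewrite ?andbF.
  rewrite -big_nat big_nat_rev /= fact_prod big_add1 /=.
  by apply: eq_big_nat => k /andP[_ ki]; lia.
rewrite big_nat_cond (eq_bigl (fun k => i.+1 <= k < n)); last first.
  by move=> k; case: ltngtP; rewrite ?andbF ?andbT.
rewrite -big_nat -[i.+1]add0n big_addn fact_prod big_add1 /=.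
have -> : n - i.+1 = n.-1 - i by lia.
by apply: eq_big_nat => k _; lia.
Qed.

(* The product is i! (n - 1 - i)!; compare it with (n - 1)! by a binomial
   coefficient, and (n - 1)! with n^(n - 1). *)
Lemma expn_le_prod_dist n i : i < n ->
  n ^ n.-1 <= 8 ^ n * \prod_(0 <= k < n | k != i) ((k - i) + (i - k)).
Proof.
move=> iN; have n0 : 0 < n := leq_ltn_trans (leq0n i) iN.
have ni : i <= n.-1 by rewrite -ltnS prednK.
have bin_le : 'C(n.-1, i) <= 2 ^ n.
  rewrite (@leq_trans (2 ^ n.-1))// ?leq_exp2l ?leq_pred//.
  rewrite -[2]/(1 + 1) expnDn; have iN' : i < n.-1.+1 by rewrite ltnS.
  by rewrite (bigD1 (Ordinal iN'))//= !exp1n !muln1 leq_addr.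
rewrite prod_dist_fact// -(@leq_pmul2l n)// -expnS prednK//.
rewrite (leq_trans (expn_le_fact n))// -[in n`!](prednK n0) factS prednK//.
rewrite -(bin_fact ni) (_ : 8 = 4 * 2)// expnMn.
rewrite mulnCA leq_mul2l mulnA mulnA -[X in _ <= X]mulnA mulnA; apply/orP; right.
by rewrite -mulnA leq_mul2r mulnC leq_mul2l bin_le !orbT.
Qed.

End ProductOfDistances.

(** * Lagrange interpolation polynomials and the size of their coefficients *)

Section LagrangePolynomials.
Context {F : numFieldType}.

Definition lagrange n (z : 'I_n -> F) (i : 'I_n) : {poly F} :=
  \prod_(k | k != i) ((z i - z k)^-1 *: ('X - (z k)%:P)).

Lemma horner_lagrange n (z : 'I_n -> F) i k : injective z ->
  (lagrange z i).[z k] = (i == k)%:R.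
Proof.
move=> zinj; rewrite horner_prod; have [<-|ik] := eqVneq i k.
  apply: big1 => l li; rewrite hornerZ hornerXsubC mulVf// subr_eq0.
  by rewrite (inj_eq zinj) eq_sym.
rewrite (bigD1 k) 1?eq_sym//= hornerZ hornerXsubC subrr mulr0 mul0r//.
Qed.

Lemma size_lagrange n (z : 'I_n -> F) i : (size (lagrange z i) <= n)%N.
Proof.
have n0 : (0 < n)%N by case: n i {z} => // -[].
rewrite /lagrange scaler_prod (leq_trans (size_scale_leq _ _))//.
rewrite size_prod => [|k _]; last by rewrite polyXsubC_eq0.
rewrite (eq_bigr (fun=> 2)) => [|k _]; last by rewrite size_XsubC.
rewrite sum_nat_const cardC1 card_ord; lia.
Qed.

(** Multiplying a polynomial by u (X - z) with |z| <= 1 multiplies the sum of the moduli of its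
    coefficients by at most 2 |u|. *)
Lemma sum_coef_prod_le I (r : seq I) (P : pred I) (u z : I -> F) D :
  (forall k, `|z k| <= 1) ->
  \sum_(l < D) `|(\prod_(k <- r | P k) (u k *: ('X - (z k)%:P)))`_l|
    <= \prod_(k <- r | P k) (`|u k| * 2).
Proof.
move=> z1; elim: r => [|k r IH].
  rewrite !big_nil; case: D => [|D]; first by rewrite big_ord0.
  rewrite big_ord_recl coef1 normr1 big1 ?addr0// => l _.
  by rewrite coef1 normr0.
rewrite !big_cons; case: ifP => // _; set q := \prod_(_ <- r | _) _ in IH *.
apply: le_trans (ler_wpM2l _ IH); last by rewrite mulr_ge0.
rewrite mulr_sumr.
have -> : 2 = 1 + 1 :> F by [].
under [leRHS]eq_bigr do rewrite -mulrA mulrDl !mul1r.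
rewrite -mulr_sumr big_split/=.
under eq_bigr do rewrite -scalerAl coefZ normrM.
rewrite -mulr_sumr ler_wpM2l//.
apply: (@le_trans _ _ (\sum_(l < D) (`|('X * q)`_l| + `|q`_l|))).
  apply: ler_sum => l _; rewrite mulrBl coefB (le_trans (ler_normB _ _))// lerD2l.
  by rewrite coefCM normrM ler_piMl.
rewrite big_split/= lerD2r; case: D {IH} => [|D]; first by rewrite !big_ord0.
rewrite big_ord_recl coefXM normr0 add0r big_ord_recr/= -[leLHS]addr0 lerD//.
by rewrite le_eqVlt; apply/orP; left; apply/eqP/eq_bigr => l _; rewrite coefXM.
Qed.

End LagrangePolynomials.

(** * The geometric lower bound for c_0 = 0 *)

Section GeometricDecay.
Context {R : realType}.
Local Notation C := R[i].

(** Otherwise N^(w - w') = 1 for every N >= 1. The modulus at N = 2 gives w - w' = i y, and then y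
    ln N is a multiple of 2 pi for all N, although ln(N + 1) - ln N tends to 0. *)
Lemma npow_separates (w w' : C) : w != w' ->
  exists2 N, (0 < N)%N & npow N (- w) != npow N (- w').
Proof.
move=> ww'; apply: contrapT => H.
have eqN N : (0 < N)%N -> npow N (w - w') = 1.
  move=> N0; have [E|E] := eqVneq (npow N (- w)) (npow N (- w')).
    by rewrite npowD -E npowN divff// -normr_gt0 normr_npow// ltcR powR_gt0// ltr0n.
  by exfalso; apply: H; exists N.
move: ww'; rewrite -subr_eq0 => /negP; apply.
case: (w - w') eqN => x y eqN {H w w'}.
have x0 : x = 0.
  have := congr1 (fun z : C => `|z|) (eqN 2%N isT).
  rewrite normr_npow//= normr1 => -[] /= /(congr1 (@ln R)).
  by rewrite ln_powR ln1 => /eqP; rewrite mulf_eq0 (gt_eqF (ln_gt0 _)) ?ltr1n// orbF => /eqP.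
have [->|y0] := eqVneq y 0; first by rewrite x0.
have cosN N : (0 < N)%N -> cos (y * ln N%:R) = 1 /\ sin (y * ln N%:R) = 0.
  move=> N0; have := eqN N N0; rewrite /npow /cexp x0 /= !(mul0r, mulr0) subrr add0r expR0.
  by case; rewrite !mul1r !mul0r subr0 addr0.
(* With N > |y| one has |y d| <= 1 < pi, and cosine is injective on [0, pi]. *)
pose N := (Num.truncn `|y|).+1.
have yN : `|y| < N%:R by rewrite truncnS_gt.
have [c1 s1] := cosN N.+1 isT; have [c2 s2] := cosN N isT.
pose d := ln N.+1%:R - ln N%:R : R.
have d0 : 0 < d by rewrite subr_gt0 ltr_ln ?posrE ?ltr0n// ltr_nat.
have dN : d <= N%:R^-1.
  rewrite /d -ln_div ?posrE ?ltr0n//.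
  rewrite (_ : _ / _ = 1 + N%:R^-1); first by rewrite le_ln1Dx// (lt_trans (ltrN10 R))// invr_gt0.
  by rewrite -natr1 mulrDl divff ?pnatr_eq0// mul1r.
have : cos (`|y * d|) = cos 0.
  by rewrite cos_norm cos0 mulrBr cosB c1 c2 s1 mulr1 mul0r addr0.
have yd1 : `|y * d| <= 1.
  rewrite normrM (gtr0_norm d0) (@le_trans _ _ (N%:R * N%:R^-1))//.
    by rewrite ler_pM// ltW.
  by rewrite divff// pnatr_eq0.
have pi2 := @pi_ge2 R.
move/cos_inj; rewrite !in_itv/= !lexx normr_ge0 pi_ge0 => /(_ _ isT) yd.
have /eqP : `|y * d| = 0 by apply: yd => //; rewrite (le_trans yd1)//; lra.
by rewrite normr_eq0 mulf_eq0 (negbTE y0) (gt_eqF d0).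
Qed.

Variables (phi : C -> C) (c : nat -> C) (T : {linear H2 R -> H2 R}).
Hypotheses (phi_self : analytic_self_map phi) (phiE : has_expansion phi 0 c).
Hypothesis (TE : is_composition_operator phi T).

(** If phi took a single value at the integers j >= 3, uniqueness of expansions would give c_n = 0
    for n >= 2, and phi would be c_1 on the whole half-plane. *)
Lemma nonconstant_nat : nonconstant_on (half_plane 2^-1) phi ->
  exists j k, [/\ (2 < j)%N, (j < k)%N & phi j%:R != phi k%:R].
Proof.
move=> [s [t [Ds Dt]]]; apply: contra_neqP => H.
have phi3 j : (2 < j)%N -> phi j%:R = phi 3%:R.
  rewrite leq_eqVlt => /orP[/eqP<-//|j3].
  have [//|/eqP ne] := eqVneq (phi j%:R) (phi 3%:R); exfalso; apply: H.
  by exists 3%N, j; split => //; apply/eqP => /esym.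
have cE n : (1 < n)%N -> c n = 0.
  move=> n1; pose d (n : nat) := if n == 1%N then phi 3%:R else 0.
  suff : c n = d n by rewrite /d gtn_eqF.
  apply: (expands_unique (expands_expansion phiE (ltn0Sn n))); last by rewrite (ltnW n1)/=.
  exists 0 => j j3; rewrite mul0r mul0r subr0 phi3// /dirichlet_sum big_ltn ?ltnS ?(ltnW n1)//.
  rewrite big_nat_cond big1 => [|i /andP[/andP[i1 _] _]].
    by rewrite /d eqxx expr1n invr1 mulr1 addr0 subrr normr0.
  by rewrite /d gtn_eqF// mul0r.
have phic u : half_plane 2^-1 u -> phi u = c 1%N.
  move=> /phiE; rewrite mul0r subr0 => cu.
  suff c1 : dirichlet_partial c u @ \oo --> c 1%N by exact: (cvg_unique _ cu c1).
  apply: cvg_near_cst; near=> N.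
  have N1 : (1 < N)%N by near: N; exact: nbhs_infty_gt.
  rewrite /dirichlet_partial big_ltn// big_nat_cond big1 ?npow1 ?mulr1 ?addr0//.
  by move=> i /andP[/andP[i1 _] _]; rewrite cE// mul0r.
by rewrite !phic.
Unshelve. all: by end_near. Qed.

Lemma continuous_real_part (p : C -> R) (t : R) :
  (forall z, (`|p z|)%:C <= `|z|) -> (forall z w, p (z - w) = p z - p w) ->
  2^-1 < t -> {for t, continuous (fun x : R => p (phi x%:C))}.
Proof.
move=> pz pB t2.
have : {for t%:C, continuous phi}.
  apply/differentiable_continuous/derivable1_diffP.
  exact: phi_self.1.
move=> /cvgrPdist_lt phic; apply/cvgrPdist_lt => e e0.
have eC : 0 < e%:C by rewrite ltcR.
have /nbhs_ballP[d d0 dP] := phic _ eC.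
(* Radii of balls in [R[i]] are elements of [R[i]]; being positive makes them real. *)
have [d' d'0 dE] : exists2 d', 0 < d' & d = d'%:C.
  by case: d d0 {dP} => a b; rewrite /= ltcE/= => /andP[/eqP -> a0]; exists a.
apply/nbhs_ballP; exists d' => // x; rewrite /ball/= => tx.
rewrite -pB -ltcR (le_lt_trans (pz _))//; apply: dP.
rewrite /ball/= dE -rmorphB normc_def/= expr0n addr0 sqrtr_sqr ltcR.
exact: tx.
Qed.

Lemma continuous_npow (N : nat) (t : R) : 2^-1 < t ->
  {for t, continuous (fun x : R => complex.Re (npow N (- phi x%:C)))} /\
  {for t, continuous (fun x : R => complex.Im (npow N (- phi x%:C)))}.
Proof.
move=> t2.
have cRe : {for t, continuous (fun x : R => complex.Re (phi x%:C))}.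
  by apply: continuous_real_part => // [|[? ?] [? ?]]//; exact: normr_Re_le.
have cIm : {for t, continuous (fun x : R => complex.Im (phi x%:C))}.
  by apply: continuous_real_part => // [|[? ?] [? ?]]//; exact: normr_Im_le.
pose L : R := ln N%:R.
have E (z : C) : npow N (- z) = (expR (- complex.Re z * L) * cos (- complex.Im z * L))
    +i* (expR (- complex.Re z * L) * sin (- complex.Im z * L)).
  case: z => a b; rewrite /npow /cexp /= !(mulr0, mul0r, subr0, add0r, addr0).
  by apply/eqP; rewrite eq_complex /= !mul0r subr0 addr0 !eqxx.
have cexpL : {for t, continuous (fun x : R => expR (- complex.Re (phi x%:C) * L))}.
  apply: (continuous_comp (f := fun x : R => - complex.Re (phi x%:C) * L)).
    by apply: continuousM; [exact: continuousN | exact: cst_continuous].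
  exact: continuous_expR.
have cImL : {for t, continuous (fun x : R => - complex.Im (phi x%:C) * L)}.
  by apply: continuousM; [exact: continuousN | exact: cst_continuous].
split.
  rewrite (_ : (fun x : R => complex.Re _) = (fun x : R =>
    expR (- complex.Re (phi x%:C) * L) * cos (- complex.Im (phi x%:C) * L))).
    apply: continuousM => //.
    by apply: (continuous_comp cImL); exact: continuous_cos.
  by apply/funext => x; rewrite E.
rewrite (_ : (fun x : R => complex.Im _) = (fun x : R =>
  expR (- complex.Re (phi x%:C) * L) * sin (- complex.Im (phi x%:C) * L))).
  apply: continuousM => //.
  by apply: (continuous_comp cImL); exact: continuous_sin.
by apply/funext => x; rewrite E.
Qed.

(** On a real segment, the real or the imaginary part of N^(-phi) takes distinct values at the two
    ends; [L] is the distance between these values. *)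
Lemma separated_points : nonconstant_on (half_plane 2^-1) phi ->
  exists N (L : R), [/\ (0 < N)%N, 0 < L & forall n, exists t : 'I_n -> R,
    (forall i, 2 <= t i) /\ forall i k : 'I_n,
      (L / n%:R * ((k - i) + (i - k))%N%:R)%:C <=
      `|npow N (- phi (t i)%:C) - npow N (- phi (t k)%:C)|].
Proof.
move=> /nonconstant_nat[a [b [a2 ab /npow_separates[N N0 Nab]]]].
pose z (x : R) := npow N (- phi x%:C).
have nat_ge2 (x : R) : x \in `[a%:R, b%:R] -> 2 <= x.
  by move=> /itvP ax; rewrite (@le_trans _ _ a%:R) ?ax// ler_nat ltnW.
have [p [pz pB pc pab]] : exists p : C -> R,
    [/\ forall w, (`|p w|)%:C <= `|w|, forall w w', p (w - w') = p w - p w',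
       {within `[a%:R, b%:R], continuous (fun x => p (z x))}
     & p (z a%:R) != p (z b%:R)].
  have cz : {within `[a%:R, b%:R], continuous (fun x => complex.Re (z x))} /\
      {within `[a%:R, b%:R], continuous (fun x => complex.Im (z x))}.
    have zc (x : R) : x \in `[a%:R, b%:R] -> 2^-1 < x.
      by move=> /nat_ge2; lra.
    split; apply: continuous_in_subspaceT => x /set_mem/zc x2.
      exact: (continuous_npow N x2).1.
    exact: (continuous_npow N x2).2.
  have [E|ne] := eqVneq (complex.Re (z a%:R)) (complex.Re (z b%:R)).
    exists (@complex.Im R); split; [exact: normr_Im_le|by move=> [? ?] [? ?]|exact: cz.2|].
    apply: contraNneq Nab => E'; rewrite -!(rmorph_nat (real_complex R)).
    by apply/eqP; move: E E'; rewrite /z; do 2!case: (npow _ _) => ? ?; move=> /= -> ->.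
  by exists (@complex.Re R); split; [exact: normr_Re_le|move=> [? ?] [? ?]|exact: cz.1|].
pose D := p (z b%:R) - p (z a%:R).
have D0 : 0 < `|D| by rewrite normr_gt0 subr_eq0 eq_sym.
exists N, `|D|; split => // n.
(* Intermediate values at equal steps D / n; [p] does not increase moduli, so they separate the
   complex values as well. *)
have ex (i : 'I_n) : exists x, x \in `[a%:R, b%:R] /\ p (z x) = p (z a%:R) + D * (i%:R / n%:R).
  have [q0 q1] : 0 <= i%:R / n%:R :> R /\ i%:R / n%:R <= 1 :> R.
    split; first by rewrite divr_ge0.
    have n0 : (0 < n)%N := leq_ltn_trans (leq0n i) (ltn_ord i).
    by rewrite ler_pdivrMr ?ltr0n// mul1r ler_nat ltnW.
  have abR : a%:R <= b%:R :> R by rewrite ler_nat ltnW.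
  have [|x xab xv] := @IVT R (fun x => p (z x)) _ _ (p (z a%:R) + D * (i%:R / n%:R)) abR pc.
    rewrite /D ge_min le_max; set q : R := _ / _ in q0 q1 *.
    have [le|/ltW le] := leP (p (z a%:R)) (p (z b%:R)).
      by apply/andP; split; apply/orP; [left|right]; nra.
    by apply/andP; split; apply/orP; [right|left]; nra.
  by exists x.
have /choice[t tP] := ex.
exists t; split => [i|i k]; first exact: nat_ge2 (tP i).1.
rewrite (le_trans _ (pz _))// pB (tP i).2 (tP k).2 lecR.
have -> : p (z a%:R) + D * (i%:R / n%:R) - (p (z a%:R) + D * (k%:R / n%:R)) =
  D / n%:R * (i%:R - k%:R) by ring.
rewrite normrM normrM [`|n%:R^-1|]ger0_norm ?invr_ge0// ler_wpM2l ?divr_ge0//.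
have [ik|ki] := leqP k i.
  by rewrite (eqP ik) add0n -natrB ?ger0_norm.
by rewrite (eqP (ltnW ki)) addn0 distrC -natrB ?ger0_norm// ltnW.
Qed.

(** The n - 1 factors are at most (2 / L) n / |k - i|. The powers of n against the distances cost
    8^n, and 1 + 2 / L >= 1 allows the exponent n - 1 to be raised to n. *)
Lemma prod_separated_le n (z : 'I_n -> C) (L : R) (i : 'I_n) : 0 < L ->
  (forall k : 'I_n, (L / n%:R * ((k - i) + (i - k))%N%:R)%:C <= `|z i - z k|) ->
  \prod_(k | k != i) (`|(z i - z k)^-1| * 2) <= ((8 * (1 + 2 / L)) ^+ n)%:C.
Proof.
move=> L0 zik; have n0 : (0 < n)%N := leq_ltn_trans (leq0n i) (ltn_ord i).
pose dist (k : 'I_n) := ((k - i) + (i - k))%N.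
have dist0 k : k != i -> (0 < dist k)%N.
  by rewrite -val_eqE /= /dist; lia.
have Ln0 : 0 < L / n%:R by rewrite divr_gt0// ltr0n.
apply: (@le_trans _ _ (\prod_(k | k != i) (2 / L * n%:R / (dist k)%:R)%:C)).
  apply: ler_prod => k ki; rewrite mulr_ge0//= normfV.
  have Ld : 0 < L / n%:R * (dist k)%:R by rewrite mulr_gt0// ltr0n dist0.
  have -> : 2 / L * n%:R / (dist k)%:R = (L / n%:R * (dist k)%:R)^-1 * 2.
    by field; rewrite !pnatr_eq0 -!lt0n n0 dist0 ?(gt_eqF L0).
  rewrite rmorphM/= fmorphV/= (rmorph_nat (real_complex R) 2) ler_wpM2r//.
  have zp : 0 < `|z i - z k| by apply: lt_le_trans (zik k); rewrite ltcR.
  by rewrite lef_pV2 ?zik// posrE//; rewrite ltcR.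
rewrite -rmorph_prod/= lecR big_split/= prodfV prodr_const cardC1 card_ord exprMn.
have P0 : 0 < \prod_(k | k != i) (dist k)%:R :> R.
  by apply: prodr_gt0 => k ki; rewrite ltr0n dist0.
rewrite ler_pdivrMr//.
have := expn_le_prod_dist (ltn_ord i); rewrite big_mkord => nP.
have {}nP : n%:R ^+ n.-1 <= 8 ^+ n * \prod_(k | k != i) (dist k)%:R :> R.
  by rewrite -natr_prod -!natrX -natrM ler_nat.
have q0 : 0 <= 2 / L by rewrite divr_ge0// ltW.
rewrite [(8 * _) ^+ n]exprMn -mulrA mulrCA ler_pM ?exprn_ge0//.
rewrite (@le_trans _ _ ((1 + 2 / L) ^+ n.-1))//.
  by rewrite lerXn2r ?nnegrE ?addr_ge0// lerDr.
by rewrite ler_weXn2l ?leq_pred// lerDl.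
Qed.

(* If x is a combination of the Lagrange basis at the points N^(-phi(t_i)), its
   coefficients are the values of T x at the t_i, so they are controlled by the
   norm of T x. *)
Lemma approximation_number_ge_geometric : bounded_operator T ->
  nonconstant_on (half_plane 2^-1) phi ->
  exists r delta : R, [/\ 0 < r, r < 1, 0 < delta &
    forall n, (1 <= n)%N -> delta * r ^+ n <= approximation_number n T].
Proof.
move=> Tb /separated_points[N [L [N0 L0 tP]]].
have [Q QE Q8] : exists2 Q, Q = 8 * (1 + 2 / L) & 8 < Q.
  by eexists; [reflexivity|have := divr_gt0 (@ltr0Sn R 1) L0; lra].
have Q0 : 0 < Q by lra.
(* Q^n bounds the norms of the basis and 2^n the number n of its elements; 1/2 comes from the bound
   2 |T x| on point values. *)
exists (2 * Q)^-1, 2^-1; split; rewrite ?invr_gt0 ?mulr_gt0//.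
  by rewrite invf_lt1 ?mulr_gt0//; lra.
move=> n n0; have [t [t2 tik]] := tP n.
pose s i := (t i)%:C; pose z i := npow N (- phi (s i)).
have hs i : half_plane 2^-1 (s i).
  by rewrite /half_plane/=; have := t2 i; lra.
(* phi maps into Re s > 1/2, so the exponent of N has negative real part. *)
have z1 i : `|z i| <= 1.
  rewrite normr_npow// lecR -[leRHS](powRr0 N%:R) ler_powR ?ler1n//.
  have := phi_self.2 _ (hs i); rewrite /half_plane/=.
  by case: (phi (s i)) => x y /= x2; lra.
have zinj : injective z.
  move=> i k zik; apply/eqP; apply: contraTT isT => ik.
  have := tik i k; rewrite -/(z i) -/(z k) zik subrr normr0 lecR.
  rewrite leNgt mulr_gt0 ?divr_gt0 ?ltr0n//.
  by move: ik; rewrite -val_eqE /=; lia.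
(* The i-th Lagrange polynomial evaluated at N^-s, as an element of H^2. *)
pose e i := \sum_(l < n) (lagrange z i)`_l *: monomial (N ^ l)%N : H2 R.
have e_le i : `|e i| <= (Q ^+ n)%:C.
  rewrite QE (le_trans _ (prod_separated_le L0 (tik i)))//.
  apply: le_trans (sum_coef_prod_le _ _ _ n z1).
  rewrite (le_trans (ler_norm_sum _ _ _))// ler_sum// => l _.
  by rewrite normrZ ler_piMr// normr_monomial_le.
apply: (approximation_number_ge (e := e)) => // a [i0 ai0] x.
have xE : x = \sum_(l < n) (\sum_i a i * (lagrange z i)`_l) *: monomial (N ^ l)%N.
  rewrite /x; under eq_bigr do rewrite scaler_sumr.
  rewrite exchange_big; apply: eq_bigr => l _; rewrite scaler_suml.
  by apply: eq_bigr => i _; rewrite scalerA.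
have Txs k : dirichlet (T x) (s k) = a k.
  rewrite TE// xE dirichlet_sum_monomial => [|l]; last by rewrite expn_gt0 N0.
  transitivity (\sum_i a i * (lagrange z i).[z k]).
    under eq_bigr do rewrite mulr_suml.
    rewrite exchange_big; apply: eq_bigr => i _.
    rewrite (horner_coef_wide _ (size_lagrange z i)) mulr_sumr.
    by apply: eq_bigr => l _; rewrite npow_X// mulrA.
  rewrite (bigD1 k)//= horner_lagrange// eqxx mulr1 big1 ?addr0// => i ik.
  by rewrite horner_lagrange// (negbTE ik) mulr0.
have a_le k : `|a k| <= 2 * `|T x|.
  by rewrite -Txs normr_dirichlet_le//; exact: t2.
split.
  apply: contraNneq ai0 => Tx0; rewrite -normr_le0 (le_trans (a_le i0))//.
  by rewrite Tx0 normr0 mulr0.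
have x_le : `|x| <= (2 * (2 * Q) ^+ n)%:C * `|T x|.
  apply: (@le_trans _ _ (\sum_(i < n) (2 * `|T x|) * (Q ^+ n)%:C)).
    rewrite (le_trans (ler_norm_sum _ _ _))// ler_sum// => i _.
    by rewrite normrZ ler_pM.
  rewrite sumr_const card_ord -[leLHS]mulr_natl.
  have -> : (2 * (2 * Q) ^+ n)%:C * `|T x| = 2 ^+ n * (2 * `|T x| * (Q ^+ n)%:C).
    by rewrite exprMn !rmorphM/= !rmorphXn/= !(rmorph_nat (real_complex R)); ring.
  rewrite ler_wpM2r//; first by rewrite mulr_ge0 ?mulr_ge0// ler0c exprn_ge0// ltW.
  by rewrite -natrX ler_nat ltnW// ltn_expl.
rewrite exprVn -invfM rmorphV ?unitfE ?gt_eqF ?mulr_gt0 ?exprn_gt0 ?mulr_gt0//=.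
by rewrite mulrC ler_pdivrMr ?ltcR ?mulr_gt0 ?exprn_gt0 ?mulr_gt0// mulrC.
Qed.

End GeometricDecay.

(** * The three cases c_0 = 0, c_0 = 1 and c_0 > 1 *)

Unset Implicit Arguments.

Theorem theorem1p2 (R : realType) (c0 : nat) (c : nat -> R[i])
    (phi : R[i] -> R[i]) (Cphi : {linear H2 R -> H2 R})
    (phi_self : analytic_self_map phi)
    (phiE : has_expansion phi c0 c)
    (CphiE : is_composition_operator phi Cphi)
    (Cphi_compact : compact_operator Cphi)
    (phi_nonconst : c0 = 0%N -> nonconstant_on (half_plane 2^-1) phi) :
  [/\ c0 = 0%N ->
        exists r delta : R, [/\ 0 < r, r < 1, 0 < delta &
          forall n, (1 <= n)%N ->
            delta * r ^+ n <= approximation_number n Cphi],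
      c0 = 1%N ->
        forall eps : R, 0 < eps ->
        exists2 delta : R, 0 < delta &
          forall n, (1 <= n)%N ->
            delta * n%:R `^ (- complex.Re (c 1%N) - eps)
              <= approximation_number n Cphi
    & (1 < c0)%N ->
        exists A delta : R, [/\ 0 < A, 0 < delta &
          forall n, (1 <= n)%N ->
            delta * n%:R `^ (- A) <= approximation_number n Cphi]].
Proof.
have Tb := Cphi_compact.1.
split=> [c00|c01 eps eps0|c02].
- subst c0.
  exact: approximation_number_ge_geometric phi_self phiE CphiE Tb (phi_nonconst erefl).
- exists (2 `^ (- `|complex.Re (c 1%N)|)) => [|n n1]; first by rewrite powR_gt0.
  apply: le_trans (approximation_number_ge_powR phiE CphiE Tb _ n1); last by rewrite c01.
  by rewrite ler_wpM2l ?powR_ge0// ler_powR ?ler1n// gerBl ltW.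
(* The added 1 keeps the exponent positive even if Re c_1 = 0. *)
exists (`|complex.Re (c 1%N)| + 1), (2 `^ (- `|complex.Re (c 1%N)|)).
split=> [||n n1]; [by rewrite ltr_wpDl|by rewrite powR_gt0|].
apply: le_trans (approximation_number_ge_powR phiE CphiE Tb (ltnW c02) n1).
rewrite ler_wpM2l ?powR_ge0// ler_powR ?ler1n// lerN2.
by rewrite (le_trans (ler_norm _))// lerDl.
Qed.
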